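(* Suppose the bounded-moment assumption and the bounded-density assumption (see context) hold. Let $\widehat\psi_n$ be the double cross-fit doubly robust (DCDR) estimator of $\psi_{ecc}$. Then $$\widehat\psi_n-\psi_{ecc}=(\mathbb{P}_n-\mathbb{P})\{\varphi(Z)\}+R_{1,n}+R_{2,n},$$ where $$R_{1,n}\le \|b_\pi\|_{\mathbb{P}}\,\|b_\mu\|_{\mathbb{P}},\qquad R_{2,n}=O_{\mathbb{P}}\left(\sqrt{\frac{\mathbb{E}\|\widehat\varphi-\varphi\|_{\mathbb{P}}^2+\rho(\Sigma_n)}{n}}\right).$$ Here, for $\eta\in\{\pi,\mu\}$, $b_\eta\equiv b_\eta(X)=\mathbb{E}\{\widehat\eta(X)-\eta(X)\mid X\}$ is the pointwise bias of $\widehat\eta$ (expectation over the training data); $\rho(\Sigma_n)$ is the spectral radius of the $n\times n$ matrix $$\Sigma_n=\mathbb{E}\left(\mathrm{cov}\left[\left\{\widehat b_\varphi(X_1),\dots,\widehat b_\varphi(X_n)\right\}^T\mid X_\varphi^n\right]\right);$$ $\widehat b_\varphi(X_i)=\mathbb{E}\{\widehat\varphi(Z_i)-\varphi(Z_i)\mid X_i,D_\pi,D_\mu\}$; and $X_\varphi^n=(X_1,\dots,X_n)$ are the covariates in the estimation sample $D_\varphi$.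
   Context: Setup. $Z=(X,A,Y)$ with $X\in\mathbb{R}^d$, $A,Y\in\mathbb{R}$, has a fixed distribution $\mathbb{P}$. Put $\pi(X)=\mathbb{E}(A\mid X)$ and $\mu(X)=\mathbb{E}(Y\mid X)$. The Expected Conditional Covariance is $\psi_{ecc}=\mathbb{E}\{\mathrm{cov}(A,Y\mid X)\}$, and its un-centered efficient influence function is $\varphi(Z)=\{A-\pi(X)\}\{Y-\mu(X)\}$. DCDR estimator. $D_\mu,D_\pi,D_\varphi$ are three independent samples, each of $n$ i.i.d. copies of $Z$. An (arbitrary) estimator $\widehat\mu$ of $\mu$ is trained on $D_\mu$ and an (arbitrary) estimator $\widehat\pi$ of $\pi$ is trained on $D_\pi$. Put $\widehat\varphi(Z)=\{A-\widehat\pi(X)\}\{Y-\widehat\mu(X)\}$ and $\widehat\psi_n=\mathbb{P}_n\{\widehat\varphi(Z)\}=\frac1n\sum_{Z_i\in D_\varphi}\widehat\varphi(Z_i)$. Notation. $\mathbb{P}_n$ is the average over $D_\varphi$; $\mathbb{P}\{\varphi(Z)\}=\mathbb{E}\{\varphi(Z)\}$; $\|g\|_{\mathbb{P}}^2=\int g(z)^2\,d\mathbb{P}(z)$; $\mathbb{E}\|\widehat\varphi-\varphi\|_{\mathbb{P}}^2$ is the expectation of $\|\widehat\varphi-\varphi\|_{\mathbb{P}}^2$ over the training data. Bounded-moment assumption: $|\mu(X)|$ and $|\pi(X)|$ are bounded, and the conditional variances $\mathbb{V}(A\mid X=x)$ and $\mathbb{V}(Y\mid X=x)$ are bounded above by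 a finite constant and below by a positive constant over $x\in\mathcal{X}$. Bounded-density assumption: $X$ is continuous with support $\mathcal{X}$, a compact subset of $\mathbb{R}^d$, and its density $f$ (w.r.t. Lebesgue measure) satisfies $0<c\le f(x)\le C<\infty$ for all $x\in\mathcal{X}$. *)

(* Defs.v *)
From HB Require Import structures.
From mathcomp Require Import all_boot all_order all_algebra.
From mathcomp Require Import complex.
From mathcomp Require Import all_classical all_reals all_analysis.

Set Implicit Arguments.
Unset Strict Implicit.
Unset Printing Implicit Defensive.
Import Order.TTheory GRing.Theory Num.Theory.
Import numFieldNormedType.Exports.

Local Open Scope classical_set_scope.
Local Open Scope ring_scope.

(* [g] is a version of the regression function [w |-> E(U | W = w)], so that
   [g \o W] is a version of [E(U | sigma(W))]. *)
Definition is_condE (d1 d2 : measure_display) (T1 : measurableType d1)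
    (T2 : measurableType d2) (R : realType) (P : probability T1 R)
    (U : T1 -> R) (W : T1 -> T2) (g : T2 -> R) : Prop :=
  [/\ measurable_fun setT g,
      P.-integrable setT (EFin \o U),
      P.-integrable setT (EFin \o (g \o W)) &
      forall B : set T2, measurable B ->
        (\int[P]_(t in W @^-1` B) (U t)%:E =
         \int[P]_(t in W @^-1` B) (g (W t))%:E)%E].

(* A chosen version of [w |-> E(U | W = w)]; the default value [0] is only
   reached when [U] is not integrable (for [W] measurable, versions exist by
   Radon-Nikodym). *)
Definition condE (d1 d2 : measure_display) (T1 : measurableType d1)
    (T2 : measurableType d2) (R : realType) (P : probability T1 R)
    (U : T1 -> R) (W : T1 -> T2) : T2 -> R :=
  xget (fun=> 0) [set g | is_condE P U W g].

Definition condCov (d1 d2 : measure_display) (T1 : measurableType d1)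
    (T2 : measurableType d2) (R : realType) (P : probability T1 R)
    (U V : T1 -> R) (W : T1 -> T2) : T2 -> R :=
  condE P (fun t => (U t - condE P U W (W t)) * (V t - condE P V W (W t))) W.

Definition condVar (d1 d2 : measure_display) (T1 : measurableType d1)
    (T2 : measurableType d2) (R : realType) (P : probability T1 R)
    (U : T1 -> R) (W : T1 -> T2) : T2 -> R :=
  condCov P U U W.

(* As [I] is finite and some [B i] may be [setT], the product rule over the
   whole family contains the one over each subfamily. *)
Definition mutually_independent (d1 d2 : measure_display)
    (T1 : measurableType d1) (T2 : measurableType d2) (R : realType)
    (P : probability T1 R) (I : finType) (W : I -> T1 -> T2) : Prop :=
  forall B : I -> set T2, (forall i, measurable (B i)) ->
    (P (\bigcap_(i in [set: I]) (W i @^-1` B i)) =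
     \prod_(i : I) P (W i @^-1` B i))%E.

Definition iid_copies (d1 d2 : measure_display) (T1 : measurableType d1)
    (T2 : measurableType d2) (R : realType) (P : probability T1 R)
    (Q : probability T2 R) (I : finType) (W : I -> T1 -> T2) : Prop :=
  [/\ forall i, measurable_fun setT (W i),
      forall i (B : set T2), measurable B -> P (W i @^-1` B) = Q B &
      mutually_independent P W].

Definition join3 (n : nat) (T : Type) (D1 D2 D3 : 'I_n -> T)
    (k : 'I_n + 'I_n + 'I_n) : T :=
  match k with
  | inl (inl i) => D1 i
  | inl (inr i) => D2 i
  | inr i => D3 i
  end.

(* [S n] is [O_P(a n)]; a rate equal to [+oo] imposes no constraint. *)
Definition bounded_in_prob (d1 : measure_display) (T1 : measurableType d1)
    (R : realType) (P : probability T1 R) (S : nat -> T1 -> R)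
    (a : nat -> \bar R) : Prop :=
  forall e : R, 0 < e -> exists2 M : R, 0 < M &
    \forall n \near \oo,
      (P [set t | M%:E * a n < `|S n t|%:E] <= e%:E)%E.

Definition spectral_radius (R : realType) (n : nat) (S : 'M[R]_n) : R :=
  sup [set r : R | exists2 l : R[i],
         eigenvalue (map_mx (real_complex R) S) l & r = Normc.normc l].

Definition cons_pair (R : realType) (d : nat) (p : R * d.-tuple R) :
    d.+1.-tuple R :=
  [tuple of p.1 :: p.2].

Lemma measurable_cons_pair (R : realType) (d : nat) :
  measurable_fun setT (@cons_pair R d).
Proof. exact: measurable_cons. Qed.

Definition lebesgue_cons (R : realType) (d : nat)
    (m : {sigma_finite_measure set (d.-tuple R) -> \bar R}) :
    set (d.+1.-tuple R) -> \bar R :=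
  pushforward (lebesgue_measure \x m)%E (@cons_pair R d).

Section lebesgue_cons.
Context (R : realType) (d : nat).
Context (m : {sigma_finite_measure set (d.-tuple R) -> \bar R}).
Local Open Scope ereal_scope.

Let mu : {measure set (d.+1.-tuple R) -> \bar R} :=
  measure_function_pushforward__canonical__measure_function_Measure
    (product_measure1 (@lebesgue_measure R) m : {measure set _ -> \bar R})
    (@measurable_cons_pair R d).

HB.instance Definition _ := isMeasure.Build _ _ _ (lebesgue_cons m)
  (measure0 mu) (measure_ge0 mu) (@measure_semi_sigma_additive _ _ _ mu).

Let sigma_finite_lebesgue_cons : sigma_finite setT (lebesgue_cons m).
Proof.
have /sigma_finiteP[F [TF ndF Foo]] := sigma_finiteT (@lebesgue_measure R).
have /sigma_finiteP[G [TG ndG Goo]] := sigma_finiteT m.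
pose u (t : d.+1.-tuple R) : R * d.-tuple R := (thead t, [tuple of behead t]).
have uK : cancel (@cons_pair R d) u.
  by case=> x t; rewrite /u theadE; congr pair; exact: val_inj.
exists (fun n => u @^-1` (F n `*` G n)).
  apply/esym; rewrite -subTset => t _.
  have [i _ Fi] : (\bigcup_i F i) (u t).1 by rewrite -TF.
  have [j _ Gj] : (\bigcup_i G i) (u t).2 by rewrite -TG.
  exists (maxn i j) => //; split.
  - by move: Fi; exact/subsetPset/ndF/leq_maxl.
  - by move: Gj; exact/subsetPset/ndG/leq_maxr.
move=> k; have [mF Fk] := Foo k; have [mG Gk] := Goo k.
split.
  rewrite -[X in measurable X]setTI.
  apply: measurable_fun_pair => //.
  - exact: measurable_tnth.
  - exact: measurable_behead.
  - exact: measurableX.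
rewrite /lebesgue_cons /pushforward -comp_preimage.
rewrite (_ : u \o @cons_pair R d = id); last exact/funext.
by rewrite preimage_id product_measure1E// lte_mul_pinfty// ge0_fin_numE.
Qed.

HB.instance Definition _ := Measure_isSigmaFinite.Build _ _ _
  (lebesgue_cons m) sigma_finite_lebesgue_cons.

End lebesgue_cons.

Fixpoint lebesgue_Rd (R : realType) (d : nat) :
    {sigma_finite_measure set (d.-tuple R) -> \bar R} :=
  match d with
  | 0%N => dirac [tuple]
  | d'.+1 => lebesgue_cons (lebesgue_Rd R d')
  end.

Lemma lebesgue_Rd_box (R : realType) (d : nat) (B : 'I_d -> set R) :
  (forall i, measurable (B i)) ->
  lebesgue_Rd R d [set t | forall i, B i (tnth t i)] =
  (\prod_(i < d) lebesgue_measure (B i))%E.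
Proof.
elim: d B => [|d IH] B mB.
  rewrite big_ord0 /= /dirac indicE mem_set//.
  by move=> [].
rewrite big_ord_recl /=.
rewrite -(IH (fun i => B (lift ord0 i)))//.
set C := [set t : d.-tuple R | forall i, B (lift ord0 i) (tnth t i)].
have mC : measurable C.
  rewrite (_ : C = \bigcap_(i in [set: 'I_d])
     ((fun t => tnth t i) @^-1` B (lift ord0 i))); last first.
    by apply/seteqP; split=> t /= Bt i; [move=> _; exact: Bt|exact: Bt].
  apply: fin_bigcap_measurable => // i _.
  rewrite -[X in measurable X]setTI.
  exact: measurable_tnth.
rewrite /lebesgue_cons /pushforward.
rewrite (_ : _ @^-1` _ = B ord0 `*` C).
  by rewrite [LHS]product_measure1E//; exact: mB.
apply/seteqP; split=> [[x t] /= Bt|[x t] [/= Bx Bt] i].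
  split=> [|i]; first exact: (Bt ord0).
  by have := Bt (lift ord0 i); rewrite tnthS.
by case: (unliftP ord0 i) => [j ->|->]; [rewrite tnthS; exact: Bt|].
Qed.

(* An observation [Z = (X, A, Y)], with [R^d] encoded as [d.-tuple R], which
   carries the product (= Borel) sigma-algebra. *)
Notation obs R d := (d.-tuple R * R * R)%type (only parsing).
Definition obsX (R : realType) (d : nat) (z : obs R d) : d.-tuple R := z.1.1.
Definition obsA (R : realType) (d : nat) (z : obs R d) : R := z.1.2.
Definition obsY (R : realType) (d : nat) (z : obs R d) : R := z.2.

(* Only row vectors carry a topology in the library. *)
Definition to_row (R : realType) (d : nat) (x : d.-tuple R) : 'rV[R]_d :=
  \row_i tnth x i.

Definition supportX (R : realType) (d : nat) (PZ : probability (obs R d) R) :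
    set (d.-tuple R) :=
  [set x | forall U : set 'rV[R]_d, open U -> U (to_row x) ->
     (0 < PZ [set z | U (to_row (obsX z))])%E].

Definition densityX (R : realType) (d : nat) (PZ : probability (obs R d) R)
    (f : d.-tuple R -> R) : Prop :=
  [/\ measurable_fun setT f, forall x, 0 <= f x &
      forall B : set (d.-tuple R), measurable B ->
        PZ (@obsX R d @^-1` B) = (\int[lebesgue_Rd R d]_(x in B) (f x)%:E)%E].

Definition bounded_density (R : realType) (d : nat)
    (PZ : probability (obs R d) R) : Prop :=
  compact (@to_row R d @` supportX PZ) /\
  exists f : d.-tuple R -> R, densityX PZ f /\
    exists c C : R, 0 < c /\ forall x, supportX PZ x -> c <= f x <= C.

Definition pi_reg (R : realType) (d : nat) (PZ : probability (obs R d) R) :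
    d.-tuple R -> R :=
  condE PZ (@obsA R d) (@obsX R d).

Definition mu_reg (R : realType) (d : nat) (PZ : probability (obs R d) R) :
    d.-tuple R -> R :=
  condE PZ (@obsY R d) (@obsX R d).

(* Regression functions are determined up to null sets of the law of [X], hence
   the almost-everywhere bounds. The positive lower bounds on the conditional
   variances exclude the default value of [condE] there. *)
Definition bounded_moment (R : realType) (d : nat)
    (PZ : probability (obs R d) R) : Prop :=
  [/\ PZ.-integrable setT (EFin \o @obsA R d),
      PZ.-integrable setT (EFin \o @obsY R d),
      exists M : R, {ae PZ, forall z,
        `|mu_reg PZ (obsX z)| <= M /\ `|pi_reg PZ (obsX z)| <= M} &
      exists c C : R, 0 < c /\ {ae PZ, forall z,
        c <= condVar PZ (@obsA R d) (@obsX R d) (obsX z) <= C /\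
        c <= condVar PZ (@obsY R d) (@obsX R d) (obsX z) <= C}].

(* [psi_ecc] and the other expectations below are taken in [R]: [fine] sends an
   undefined or infinite expectation to [0]. *)
Definition psi_ecc (R : realType) (d : nat) (PZ : probability (obs R d) R) : R :=
  fine 'E_PZ[fun z => condCov PZ (@obsA R d) (@obsY R d) (@obsX R d) (obsX z)].

Definition phi (R : realType) (d : nat) (p m : d.-tuple R -> R) (z : obs R d) :
    R :=
  (obsA z - p (obsX z)) * (obsY z - m (obsX z)).

(* [etahat n D x]: value at [x] of the estimate fitted on the [n] data [D]. *)
Definition estimator (R : realType) (d : nat) : Type :=
  forall n : nat, n.-tuple (obs R d) -> d.-tuple R -> R.

Definition measurable_estimator (R : realType) (d : nat)
    (etahat : estimator R d) : Prop :=
  forall n, measurable_fun setT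
    (fun q : n.-tuple (obs R d) * d.-tuple R => etahat n q.1 q.2).

Definition sample (R : realType) (d : nat) (T : Type) (n : nat)
    (D : 'I_n -> T -> obs R d) (t : T) : n.-tuple (obs R d) :=
  [tuple D i t | i < n].

Definition sampleX (R : realType) (d : nat) (T : Type) (n : nat)
    (D : 'I_n -> T -> obs R d) (t : T) : n.-tuple (d.-tuple R) :=
  [tuple obsX (D i t) | i < n].

Definition emp_mean (R : realType) (d : nat) (T : Type) (n : nat)
    (D : 'I_n -> T -> obs R d) (t : T) (g : obs R d -> R) : R :=
  n%:R^-1 * \sum_(i < n) g (D i t).

(* [b_eta x], the expectation being over the training data [D]. *)
Definition pbias (dT : measure_display) (T : measurableType dT) (R : realType)
    (P : probability T R) (d : nat) (eta : d.-tuple R -> R)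
    (etahat : estimator R d) (n : nat) (D : 'I_n -> T -> obs R d)
    (x : d.-tuple R) : R :=
  fine 'E_P[fun t => etahat n (sample D t) x - eta x].

Definition norm2 (R : realType) (d : nat) (PZ : probability (obs R d) R)
    (g : obs R d -> R) : \bar R :=
  'N[PZ]_(2%:E)[EFin \o g]%E.

Section dcdr.
Context (dT : measure_display) (T : measurableType dT) (R : realType).
Context (P : probability T R) (d : nat) (PZ : probability (obs R d) R).
Context (pihat muhat : estimator R d) (n : nat).
Context (Dpi Dmu Dphi : 'I_n -> T -> obs R d).

Definition phihat (t : T) : obs R d -> R :=
  phi (@pihat n (sample Dpi t)) (@muhat n (sample Dmu t)).

Definition psihat (t : T) : R := emp_mean Dphi t (phihat t).

Definition phi0 : obs R d -> R := phi (pi_reg PZ) (mu_reg PZ).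

(* Arbitrary estimators make this possibly infinite, in which case [R2_rate] is
   [+oo]. When it is finite, all the conditional moments entering [Sigma_mx]
   exist and no default value is involved there. *)
Definition mean_sq_error : \bar R :=
  (\int[P]_t (norm2 PZ (fun z => (phihat t z - phi0 z)%R) ^+ 2))%E.

Definition bhat (i : 'I_n) (t : T) : R :=
  condE P (fun s => phihat s (Dphi i s) - phi0 (Dphi i s))
    (fun s => (obsX (Dphi i s), sample Dpi s, sample Dmu s))
    (obsX (Dphi i t), sample Dpi t, sample Dmu t).

Definition Sigma_mx : 'M[R]_n :=
  \matrix_(i, j)
    fine 'E_P[fun t => condCov P (bhat i) (bhat j) (sampleX Dphi) (sampleX Dphi t)].

Definition R2_rate : \bar R :=
  sqrte ((mean_sq_error + (spectral_radius Sigma_mx)%:E) * (n%:R^-1)%:E)%E.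

End dcdr.

(* Main.v *)
(* Write a, y for the residuals A - pi(X), Y - mu(X), and u, v for the errors
   pihat - pi, muhat - mu of the two fits. The error of the estimated influence
   function is w = phihat - phi = u v - a v - u y, so that E(w | X, Dpi, Dmu) =
   u v, and E(u v | X) = b_pi(X) b_mu(X) because Dpi and Dmu are independent.
   Hence R1 = E(w) = E(b_pi b_mu), bounded by Cauchy-Schwarz, and R2 is the
   average over Dphi of
     (w_i - u_i v_i) + (u_i v_i - b_pi b_mu(X_i)) + (b_pi b_mu(X_i) - R1).
   In the first and third sums the terms are pairwise uncorrelated, so their
   second moments are O(E(w^2) / n); the second moment of the middle sum is
   1^T Sigma 1 / n^2 <= rho(Sigma) / n. Chebyshev's inequality concludes.

   A finite mean squared error makes w square-integrable, but a v and u y need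
   not be integrable, so the conditional expectation of w given (X, Dpi, Dmu) is
   first computed after multiplication by the weight 1 / ((1 + u^2) (1 + v^2)),
   which is a function of the conditioning variables. *)
Require Import Defs.
From HB Require Import structures.
From mathcomp Require Import all_boot all_order all_algebra.
From mathcomp Require Import complex spectral sesquilinear.
From mathcomp Require Import all_classical all_reals all_analysis.
From mathcomp Require Import measurable_realfun ring lra.

Set Implicit Arguments.
Unset Strict Implicit.
Unset Printing Implicit Defensive.
Import Order.TTheory GRing.Theory Num.Theory.
Import numFieldNormedType.Exports.

Local Open Scope classical_set_scope.
Local Open Scope ring_scope.

(** [condE] picks an arbitrary version and [fine] turns a divergent expectation into 0. Identities
    are therefore proved for explicit versions and transferred almost everywhere to the chosen ones,
    and three facts have to survive divergence: psi_ecc = E(phi0), the factorisation of E(u v) at a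
    fixed x, and the bound on R1. This is why R1 is defined as the integral of b_pi b_mu rather than
    as E(w): no moment of w enters it. A finite mean squared error is used only for R2, whose rate
    is [+oo] otherwise. Independence is given as a product rule on single observations. Dynkin's
    argument lifts it to the sigma-algebras of disjoint blocks, and Fubini's theorem for the product
    law turns conditioning on a block into freezing it. Two errors w_i and w_j share the training
    data, so they are not independent; conditioning the i-th one also on Z_j is what decorrelates
    them once they are centred by u v. *)

(** * Spectral radius and quadratic forms *)

Section spectral_radius.
Local Open Scope sesquilinear_scope.

(** The point is that the [sup] is taken over a bounded set: every eigenvalue is a root of the
    characteristic polynomial, so the sum of the moduli of all roots is an upper bound. *)
Lemma eigenvalue_le_spectral_radius (R : realType) n (S : 'M[R]_n) (l : R[i]) :
  eigenvalue (map_mx (real_complex R) S) l ->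
  Normc.normc l <= spectral_radius S.
Proof.
move=> el; apply: ub_le_sup; last by exists l.
have [s sE] := closed_field_poly_normal (char_poly (map_mx (real_complex R) S)).
exists (\sum_(z <- s) Normc.normc z) => _ [z ez ->].
have : z \in s.
  move: ez; rewrite eigenvalue_root_char sE rootZ ?root_prod_XsubC//.
  by rewrite lead_coef_eq0 -size_poly_eq0 size_char_poly.
have nc0 (y : R[i]) : 0 <= Normc.normc y by case: y => a b; rewrite sqrtr_ge0.
by move=> zs; rewrite (big_rem z)//= lerDl sumr_ge0.
Qed.

Lemma spectral_radius_ge0 (R : realType) n (S : 'M[R]_n) : (0 < n)%N ->
  0 <= spectral_radius S.
Proof.
move=> n0; have [l el] := eigenvalue_closed (map_mx (real_complex R) S) n0.
apply: le_trans (eigenvalue_le_spectral_radius el).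
by case: l {el} => a b; rewrite sqrtr_ge0.
Qed.

(** Over [R[i]] a real symmetric matrix is hermitian, hence unitarily diagonalisable with real
    eigenvalues [sp]. In the rotated coordinates [y] the form is the sum of [sp 0 k * |y_k|^2], and
    the rotation preserves the sum of squares. *)
Lemma quadratic_form_le (R : realType) n (S : 'M[R]_n) (x : 'rV[R]_n) :
  S^T = S ->
  (x *m S *m x^T) 0 0 <= spectral_radius S * \sum_i x 0 i ^+ 2.
Proof.
move=> symS; pose A := map_mx (real_complex R) S.
pose xc := map_mx (real_complex R) x.
have cR (a : R) : (real_complex R a)^* = real_complex R a.
  by apply/CrealP/complex_realP; exists a.
have rmx m p (M : 'M[R]_(m, p)) :
    map_mx (real_complex R) M ^ Num.conj = map_mx (real_complex R) M.
  by apply/matrixP => i j; rewrite !mxE cR.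
have hA : A \is hermsymmx.
  apply/is_hermitianmxP; rewrite expr0 scale1r.
  by rewrite /A map_trmx symS rmx.
have /orthomx_spectralP AE := hermitian_normalmx hA.
set Q := spectralmx A in AE; set sp := spectral_diag A in AE.
have uQ : Q \is unitarymx := spectral_unitarymx A.
have QQ : Q^t* *m Q = 1%:M by rewrite -invmx_unitary// mulVmx// spectral_unit.
(* The rows of [Q] are eigenvectors; they are nonzero because a unitary matrix has rows of norm
   1. *)
have ev k : eigenvalue A (sp 0 k).
  apply/eigenvalueP; exists (row k Q).
    rewrite -row_mul [in LHS]AE !mulmxA mulmxV ?spectral_unit// mul1mx.
    by apply/rowP => j; rewrite mul_diag_mx !mxE.
  apply/negP => /eqP rk0.
  have /matrixP/(_ k k) := elimT unitarymxP uQ.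
  rewrite !mxE eqxx big1 => [/esym/eqP|j _]; first by rewrite oner_eq0.
  by have /rowP/(_ j) := rk0; rewrite !mxE => ->; rewrite mul0r.
have spr k : sp 0 k \is Num.real.
  exact: (mxOverP (hermitian_spectral_diag_real hA)).
pose y := xc *m Q^t*.
have yE : y^t* = Q *m xc^T.
  apply/matrixP => i j; rewrite !mxE rmorph_sum/=; apply: eq_bigr => k _.
  by rewrite !mxE rmorphM/= conjCK cR mulrC.
suff : real_complex R ((x *m S *m x^T) 0 0) <=
    real_complex R (spectral_radius S * \sum_i x 0 i ^+ 2) by rewrite lecR.
have -> : real_complex R ((x *m S *m x^T) 0 0) =
    \sum_k sp 0 k * (y 0 k * (y 0 k)^*).
  transitivity ((xc *m A *m xc^T) 0 0).
    by rewrite /xc /A map_trmx -!map_mxM [RHS]mxE.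
  rewrite AE invmx_unitary// !mulmxA -/y -!mulmxA -yE !mulmxA -/y.
  rewrite mul_mx_diag mxE; apply: eq_bigr => k _; move: y yE => z _.
  by rewrite !mxE mulrA [sp 0 k * _]mulrC.
have -> : real_complex R (spectral_radius S * \sum_i x 0 i ^+ 2) =
    \sum_k real_complex R (spectral_radius S) * (y 0 k * (y 0 k)^*).
  rewrite rmorphM/= -mulr_sumr; congr (_ * _).
  transitivity ((y *m y^t*) 0 0); last first.
    by rewrite mxE; apply: eq_bigr => k _; move: y yE => z _; rewrite !mxE.
  rewrite yE /y !mulmxA -(mulmxA xc) QQ mulmx1 /xc map_trmx -map_mxM [RHS]mxE.
  by congr (real_complex R _); rewrite mxE; apply: eq_bigr => k _; rewrite !mxE.
apply: ler_sum => k _; rewrite ler_wpM2r ?mul_conjC_ge0//.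
apply: le_trans (real_ler_norm (spr k)) _.
have -> : `|sp 0 k| = real_complex R (Normc.normc (sp 0 k)) by [].
by rewrite lecR; exact: eigenvalue_le_spectral_radius (ev k).
Qed.

End spectral_radius.

(** * Conditional expectations: existence, uniqueness, known factors *)

Section condE_theory.
Context (d1 d2 : measure_display) (T1 : measurableType d1)
  (T2 : measurableType d2) (R : realType) (P : probability T1 R).
Implicit Types (U V : T1 -> R) (W : T1 -> T2) (g : T2 -> R).

Lemma measurable_preimage W (B : set T2) :
  measurable_fun setT W -> measurable B -> measurable (W @^-1` B).
Proof. by move=> mW mB; rewrite -[X in measurable X]setTI; exact: mW. Qed.

Lemma integrable_comp W (f : T2 -> \bar R) (B : set T2)
    (mW : measurable_fun setT W) :
  measurable_fun setT f -> measurable B ->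
  (pushforward P W).-integrable B f <-> P.-integrable (W @^-1` B) (f \o W).
Proof.
move=> mf mB; have mfW : measurable_fun setT (f \o W) by exact: measurableT_comp.
have E : (\int[pushforward P W]_(y in B) `|f y| =
    \int[P]_(x in W @^-1` B) `|(f \o W) x|)%E.
  rewrite ge0_integral_pushforward//.
  by apply: measurableT_comp => //; exact: measurable_funTS.
split=> /integrableP[_ fi]; apply/integrableP; split; rewrite ?E// -?E//;
  exact: measurable_funTS.
Qed.

Lemma integral_comp W (f : T2 -> \bar R) : measurable_fun setT W ->
  measurable_fun setT f ->
  (\int[pushforward P W]_y f y = \int[P]_x f (W x))%E.
Proof.
move=> mW mf; rewrite integralE ge0_integral_pushforward//; last first.
  exact: measurable_funepos.
rewrite ge0_integral_pushforward//; last exact: measurable_funeneg.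
by rewrite [RHS]integralE -!(funepos_comp, funeneg_comp) preimage_setT.
Qed.

(** The signed measure with density [U] is pushed forward to [T2] before being differentiated with
    respect to the law of [W], so that the derivative is directly a function of the value of [W]. *)
Lemma is_condE_exists U W : measurable_fun setT W ->
  P.-integrable setT (EFin \o U) -> exists g, is_condE P U W g.
Proof.
move=> mW iU.
pose mfW : {mfun T1 >-> T2} := HB.pack W (isMeasurableFun.Build _ _ _ _ _ mW).
pose nu0 : {charge set T1 -> \bar R} := induced_charge iU.
pose mu : probability T2 R := distribution P mfW.
pose nu : {charge set T2 -> \bar R} :=
  measure_function_pushforward__canonical__charge_Charge nu0 mW.
have numu : nu `<< mu.
  apply/null_content_dominatesP => B mB muB.
  apply: null_set_integral => //; first exact: measurable_preimage.
  by apply: measurable_funTS; exact: measurable_int iU.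
pose f := Radon_Nikodym nu mu.
have ff x : f x \is a fin_num by exact: Radon_Nikodym_fin_num.
have fi : mu.-integrable setT f by exact: Radon_Nikodym_integrable.
have mf : measurable_fun setT f := measurable_int _ fi.
have igW : P.-integrable setT (f \o W).
  exact/(integrable_comp mW mf measurableT).
exists (fine \o f); split => //.
- exact: measurableT_comp.
- rewrite [X in P.-integrable _ X](_ : _ = f \o W)//.
  by apply/funext => x /=; rewrite fineK.
- move=> B mB; transitivity (nu B) => //.
  rewrite (Radon_Nikodym_integral numu mB) [LHS]integral_pushforward//.
    by apply: eq_integral => x _ /=; rewrite fineK.
  by apply: integrableS igW => //; exact: measurable_preimage.
Qed.

Lemma condEP U W : measurable_fun setT W ->
  P.-integrable setT (EFin \o U) -> is_condE P U W (condE P U W).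
Proof.
move=> mW iU; rewrite /condE; case: xgetP => [g -> //|].
by have [g gP] := is_condE_exists mW iU; move=> /(_ g).
Qed.

Lemma is_condE_ae_unique U W g1 g2 : measurable_fun setT W ->
  is_condE P U W g1 -> is_condE P U W g2 -> ae_eq P setT (g1 \o W) (g2 \o W).
Proof.
move=> mW [mg1 _ ig1 E1] [mg2 _ ig2 E2].
pose mfW : {mfun T1 >-> T2} := HB.pack W (isMeasurableFun.Build _ _ _ _ _ mW).
pose mu : probability T2 R := distribution P mfW.
have eq12 : ae_eq mu setT (EFin \o g1) (EFin \o g2).
  apply: integral_ae_eq => //.
  - by apply/(integrable_comp mW) => //; exact/measurable_EFinP.
  - exact/measurable_EFinP.
  - move=> B _ mB.
    rewrite [LHS]integral_pushforward//; [|exact/measurable_EFinP|]; last first.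
      by apply: integrableS ig1 => //; exact: measurable_preimage.
    rewrite [RHS]integral_pushforward//; [|exact/measurable_EFinP|]; last first.
      by apply: integrableS ig2 => //; exact: measurable_preimage.
    by rewrite -E1// E2.
have [N [mN N0 sN]] := eq12.
exists (W @^-1` N); split => //; first exact: measurable_preimage.
move=> x /= h; apply: sN => /= h2; apply: h => _.
by have /(_ I)[] := h2.
Qed.

(** [V] is assumed measurable because [P] may be incomplete: a modification on a null set can
    destroy measurability. *)
Lemma ae_eq_integrable U V : measurable_fun setT V -> ae_eq P setT U V ->
  P.-integrable setT (EFin \o U) ->
  P.-integrable setT (EFin \o V) /\
  forall D, measurable D ->
    (\int[P]_(t in D) (U t)%:E = \int[P]_(t in D) (V t)%:E)%E.
Proof.
move=> mV UV iU; have mU := measurable_int _ iU.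
have mV' : measurable_fun setT (EFin \o V) by exact/measurable_EFinP.
split.
  apply/integrableP; split => //.
  have /integrableP[_] := iU; congr (_ < _)%E.
  apply: ae_eq_integral => //.
  - exact: measurableT_comp.
  - exact: measurableT_comp.
  - by apply: filterS UV => x /= + h => -> //.
move=> D mD; apply: ae_eq_integral => //.
- exact: measurable_funTS.
- exact: measurable_funTS.
- by apply: filterS UV => x /= + h => -> //.
Qed.

Lemma is_condE_ae U V W g : measurable_fun setT V -> ae_eq P setT U V ->
  is_condE P U W g -> measurable_fun setT W -> is_condE P V W g.
Proof.
move=> mV UV [mg iU ig E] mW.
have [iV UVE] := ae_eq_integrable mV UV iU.
by split=> // B mB; rewrite -E// UVE//; exact: measurable_preimage.
Qed.

Import HBNNSimple.

(** For a simple [k] the claim is a nonnegative combination of the hypotheses on its level sets;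
    monotone convergence does the rest. Both integrals may be [+oo]. The form is an inequality
    because Jensen's inequality needs it; equalities follow by using it twice. *)
Lemma ge0_le_integral_weight W (f g : T1 -> R) (k : T2 -> R) :
  measurable_fun setT W -> measurable_fun setT f -> measurable_fun setT g ->
  measurable_fun setT k ->
  (forall x, 0 <= f x) -> (forall x, 0 <= g x) -> (forall y, 0 <= k y) ->
  (forall B, measurable B ->
    (\int[P]_(x in W @^-1` B) (f x)%:E <=
     \int[P]_(x in W @^-1` B) (g x)%:E)%E) ->
  (\int[P]_x (f x * k (W x))%:E <= \int[P]_x (g x * k (W x))%:E)%E.
Proof.
move=> mW mf mg mk f0 g0 k0 fg.
have mk' : measurable_fun setT (EFin \o k) by exact/measurable_EFinP.
pose kn := nnsfun_approx measurableT mk'.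
have knW n : measurable_fun setT (kn n \o W) by exact: measurableT_comp.
have lim (h : T1 -> R) : measurable_fun setT h -> (forall x, 0 <= h x) ->
    (\int[P]_x (h x * kn n (W x))%:E)%E @[n --> \oo] -->
    (\int[P]_x (h x * k (W x))%:E)%E.
  move=> mh h0; rewrite [X in _ --> X](_ : _ =
      \int[P]_x limn (fun n => (h x * kn n (W x))%:E))%E; last first.
    apply: eq_integral => x _; apply/esym/cvg_lim => //.
    under eq_fun do rewrite EFinM.
    rewrite EFinM; apply: cvgeZl => //.
    by apply: (cvg_nnsfun_approx measurableT mk') => // y _; rewrite lee_fin.
  apply: (@cvg_monotone_convergence _ _ _ P setT measurableT
    (fun n x => (h x * kn n (W x))%:E)) => //.
  - by move=> n; apply/measurable_EFinP/measurable_funM => //; exact: knW.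
  - by move=> n x _; rewrite lee_fin mulr_ge0.
  - move=> x _ a b ab; rewrite lee_fin ler_wpM2l//.
    exact/lefP/nd_nnsfun_approx.
have int_nn (h : T1 -> R) n : measurable_fun setT h -> (forall x, 0 <= h x) ->
    (\int[P]_x (h x * kn n (W x))%:E =
     \sum_(r \in range (kn n))
       r%:E * \int[P]_(x in W @^-1` (kn n @^-1` [set r])) (h x)%:E)%E.
  move=> mh h0.
  have mB r : measurable (W @^-1` (kn n @^-1` [set r])).
    exact: measurable_preimage.
  under eq_integral => x _.
    rewrite fimfunE mulrC EFinM -fsumEFin// ge0_mule_fsuml; last first.
      by move=> r; rewrite lee_fin; exact: nnfun_muleindic_ge0.
    over.
  rewrite ge0_integral_fsum//=; last 2 first.
  - move=> r; apply: emeasurable_funM; last exact/measurable_EFinP.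
    by apply/measurable_EFinP/measurable_funM => //; apply: measurableT_comp.
  - by move=> r x _; rewrite mule_ge0 ?lee_fin//; exact: nnfun_muleindic_ge0.
  apply: eq_fsbigr => r; rewrite inE => -[y _ <-].
  rewrite [in RHS]integral_mkcond -ge0_integralZl//.
  - apply: eq_integral => x _; rewrite patchE indicE /=.
    set B := kn n @^-1` _.
    have -> : (W x \in B) = (x \in W @^-1` B) by apply/idP/idP; rewrite !inE.
    by case: ifP => _; rewrite ?mulr1 ?mulr0 ?mul0e ?mule0.
  - apply/(measurable_restrictT _ (mB _)).
    by apply/measurable_funTS/measurable_EFinP.
  - by move=> x _; rewrite patchE; case: ifPn => // _; rewrite lee_fin.
  - by rewrite lee_fin.
apply: (lee_cvg_to (lim f mf f0) (lim g mg g0)).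
apply: nearW => n; rewrite !int_nn//; apply: lee_fsum => // r [y _ <-].
by rewrite lee_wpmul2l ?lee_fin//; apply: fg.
Qed.

Lemma integral_preimage W (f : T1 -> R) (B : set T2) :
  (\int[P]_(x in W @^-1` B) (f x)%:E = \int[P]_x (f x * \1_B (W x))%:E)%E.
Proof.
rewrite integral_mkcond; apply: eq_integral => x _; rewrite patchE indicE.
have -> : (x \in W @^-1` B) = (W x \in B) by apply/idP/idP; rewrite !inE.
by case: ifP; rewrite ?mulr1 ?mulr0.
Qed.

Lemma le_integrableR (f g : T1 -> R) : measurable_fun setT f ->
  (forall x, `|f x| <= `|g x|) ->
  P.-integrable setT (EFin \o g) -> P.-integrable setT (EFin \o f).
Proof.
move=> mf fg; apply: le_integrable => //; first exact/measurable_EFinP.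
by move=> x _; rewrite lee_fin.
Qed.

(** This is the rule for pulling a known factor out of a conditional expectation. The weight [k] may
    be unbounded, only the product being integrable. Splitting [k], then [a], into positive and
    negative parts reduces it to nonnegative weights. *)
Lemma integral_weight_eq0 W (a : T1 -> R) (k : T2 -> R) :
  measurable_fun setT W -> measurable_fun setT k ->
  P.-integrable setT (EFin \o a) ->
  (forall B, measurable B -> (\int[P]_(x in W @^-1` B) (a x)%:E = 0)%E) ->
  P.-integrable setT (fun x => (a x * k (W x))%:E) ->
  (\int[P]_x (a x * k (W x))%:E = 0)%E.
Proof.
move=> mW mk ia a0 iak.
have ma : measurable_fun setT a.
  by apply/measurable_EFinP; exact: measurable_int ia.
pose ap x : R := Num.max (a x) 0; pose an x : R := Num.max (- a x) 0.
have map_ : measurable_fun setT ap by exact: measurable_maxr.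
have man : measurable_fun setT an.
  by apply: measurable_maxr => //; exact: measurableT_comp.
have aE x : a x = ap x - an x.
  by rewrite /ap /an; case: (leP (a x) 0); case: (leP (- a x) 0); lra.
have ap0 x : 0 <= ap x by rewrite /ap le_max lexx orbT.
have an0 x : 0 <= an x by rewrite /an le_max lexx orbT.
have apa x : `|ap x| <= `|a x|.
  by rewrite ger0_norm// /ap ge_max ler_norm normr_ge0.
have ana x : `|an x| <= `|a x|.
  by rewrite ger0_norm// /an ge_max -normrN ler_norm normr_ge0.
have iap : P.-integrable setT (EFin \o ap) by exact: le_integrableR ia.
have ian : P.-integrable setT (EFin \o an) by exact: le_integrableR ia.
(* A zero integral of [a] means that its two parts have the same integral, so each dominates the
   other in [ge0_le_integral_weight]. *)
have pn B : measurable B ->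
    (\int[P]_(x in W @^-1` B) (ap x)%:E =
     \int[P]_(x in W @^-1` B) (an x)%:E)%E.
  move=> mB; have mWB : measurable (W @^-1` B) by exact: measurable_preimage.
  have iS h : P.-integrable setT (EFin \o h) ->
      P.-integrable (W @^-1` B) (EFin \o h).
    exact: integrableS.
  have := a0 B mB; under eq_integral do rewrite aE EFinB.
  rewrite integralB_EFin//; [|exact: iS|exact: iS].
  move=> /eqP; rewrite sube_eq ?add0e => [/eqP//| |].
  - exact: (integrable_fin_num mWB (iS _ iap)).
  - by rewrite fin_num_adde_defl// (integrable_fin_num mWB (iS _ ian)).
have nneg (h : T2 -> R) : measurable_fun setT h -> (forall y, 0 <= h y) ->
    P.-integrable setT (fun x => (a x * h (W x))%:E) ->
    (\int[P]_x (a x * h (W x))%:E = 0)%E.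
  move=> mh h0 iah.
  have mhW : measurable_fun setT (h \o W) by exact: measurableT_comp.
  have ipn (b : T1 -> R) : measurable_fun setT b ->
      (forall x, `|b x| <= `|a x|) ->
      P.-integrable setT (EFin \o (fun x => b x * h (W x))).
    move=> mb ba; apply: le_integrableR iah; first exact: measurable_funM.
    by move=> x; rewrite !normrM ler_wpM2r.
  under eq_integral do rewrite aE mulrBl EFinB.
  rewrite integralB_EFin//; [|exact: ipn|exact: ipn].
  rewrite (_ : (\int[P]_x (ap x * h (W x))%:E =
      \int[P]_x (an x * h (W x))%:E)%E).
    by rewrite subee// (integrable_fin_num measurableT (ipn an man ana)).
  by apply/eqP; rewrite eq_le; apply/andP; split;
    apply: ge0_le_integral_weight => // B mB; rewrite pn.
pose kp y : R := Num.max (k y) 0; pose kn y : R := Num.max (- k y) 0.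
have mkp : measurable_fun setT kp by exact: measurable_maxr.
have mkn : measurable_fun setT kn.
  by apply: measurable_maxr => //; exact: measurableT_comp.
have kE y : k y = kp y - kn y.
  by rewrite /kp /kn; case: (leP (k y) 0); case: (leP (- k y) 0); lra.
have kp0 y : 0 <= kp y by rewrite /kp le_max lexx orbT.
have kn0 y : 0 <= kn y by rewrite /kn le_max lexx orbT.
have ik (h : T2 -> R) : measurable_fun setT h ->
    (forall y, `|h y| <= `|k y|) ->
    P.-integrable setT (EFin \o (fun x => a x * h (W x))).
  move=> mh hk; apply: le_integrableR iak.
    by apply: measurable_funM => //; exact: measurableT_comp.
  by move=> x; rewrite !normrM ler_wpM2l.
have ikp := ik kp mkp; have ikn := ik kn mkn.
under eq_integral do rewrite kE mulrBr EFinB.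
rewrite integralB_EFin//; [|apply: ikp|apply: ikn].
- rewrite !nneg ?sube0//; [apply: ikn|apply: ikp] => y.
  + by rewrite ger0_norm// /kn ge_max -normrN ler_norm normr_ge0.
  + by rewrite ger0_norm// /kp ge_max ler_norm normr_ge0.
- by move=> y; rewrite ger0_norm// /kp ge_max ler_norm normr_ge0.
- by move=> y; rewrite ger0_norm// /kn ge_max -normrN ler_norm normr_ge0.
Qed.

End condE_theory.

(** * Square-integrable functions *)

Section sq_integrable.
Context (d : measure_display) (T : measurableType d) (R : realType)
  (P : probability T R).
Implicit Types f g : T -> R.

(** Measurability is a separate clause because that of [f ^+ 2] does not imply that of [f]. *)
Definition sq_integrable f :=
  measurable_fun setT f /\ P.-integrable setT (EFin \o (fun x => f x ^+ 2)).

Lemma sq_integrable_fin f : measurable_fun setT f ->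
  (\int[P]_x (f x ^+ 2)%:E < +oo)%E -> sq_integrable f.
Proof.
move=> mf fi; split => //; apply/integrableP; split.
  by apply/measurable_EFinP; exact: measurable_funX.
by under eq_integral do rewrite /= ger0_norm ?sqr_ge0//.
Qed.

Lemma sq_integrableM f g : sq_integrable f -> sq_integrable g ->
  P.-integrable setT (EFin \o (fun x => f x * g x)).
Proof.
move=> [mf if2] [mg ig2].
apply: (@le_integrableR _ _ _ P _ (fun x => f x ^+ 2 + g x ^+ 2)).
- exact: measurable_funM.
- move=> x; rewrite (ger0_norm (addr_ge0 (sqr_ge0 _) (sqr_ge0 _))) ler_norml.
  by have := sqr_ge0 (f x + g x); have := sqr_ge0 (f x - g x);
     have := sqr_ge0 (f x); have := sqr_ge0 (g x); rewrite !expr2; nra.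
- exact: (integrableD measurableT if2 ig2).
Qed.

Lemma sq_integrable_cst (c : R) : sq_integrable (cst c).
Proof.
by split => //; exact: (finite_measure_integrable_cst P (c ^+ 2) measurableT).
Qed.

Lemma sq_integrable_integrable f :
  sq_integrable f -> P.-integrable setT (EFin \o f).
Proof.
move=> /sq_integrableM/(_ (sq_integrable_cst 1)).
by apply: eq_integrable => // x _ /=; rewrite mulr1.
Qed.

Lemma sq_integrableD f g : sq_integrable f -> sq_integrable g ->
  sq_integrable (fun x => f x + g x).
Proof.
move=> hf hg; have [mf if2] := hf; have [mg ig2] := hg.
split; first exact: measurable_funD.
have := integrableD measurableT (integrableD measurableT if2 ig2)
  (integrableZl measurableT 2 (sq_integrableM hf hg)).
apply: eq_integrable => // x _ /=; rewrite -!EFinM -!EFinD; congr (_%:E); ring.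
Qed.

Lemma sq_integrableZ f (c : R) : sq_integrable f ->
  sq_integrable (fun x => c * f x).
Proof.
move=> [mf if2]; split; first exact: measurable_funM.
have := integrableZl measurableT (c ^+ 2) if2.
by apply: eq_integrable => // x _ /=; rewrite exprMn.
Qed.

Lemma sq_integrableB f g : sq_integrable f -> sq_integrable g ->
  sq_integrable (fun x => f x - g x).
Proof.
move=> hf hg; have := sq_integrableD hf (sq_integrableZ (-1) hg).
by under eq_fun do rewrite mulN1r.
Qed.

Lemma sq_integrable_sum (I : Type) (s : seq I) (f : I -> T -> R) :
  (forall i, sq_integrable (f i)) ->
  sq_integrable (fun x => \sum_(i <- s) f i x).
Proof.
move=> hf; elim: s => [|i s IH].
  by under eq_fun do rewrite big_nil; exact: (sq_integrable_cst 0).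
by under eq_fun do rewrite big_cons; exact: sq_integrableD.
Qed.

End sq_integrable.

(** * Conditional expectations identified through a bounded weight *)

Lemma measurable_funV (d : measure_display) (T : measurableType d)
    (R : realType) (f : T -> R) : measurable_fun setT f -> (forall x, 0 < f x) ->
  measurable_fun setT (fun x => (f x)^-1).
Proof.
move=> mf f0; rewrite (_ : (fun _ => _) = (fun x => expR (- ln (f x)))).
  apply: measurableT_comp => //; apply: measurableT_comp => //.
  exact: measurableT_comp.
by apply/funext => x; rewrite expRN lnK// posrE.
Qed.

(* The weight [h] gives a meaning to [E(U | W) = g(W)] before [g(W)] is known
   to be integrable. *)
Section weighted_condE.
Context (d1 d2 : measure_display) (T1 : measurableType d1)
  (T2 : measurableType d2) (R : realType) (P : probability T1 R).
Variables (U : T1 -> R) (W : T1 -> T2) (g h : T2 -> R).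
Hypotheses (mU : measurable_fun setT U) (mW : measurable_fun setT W)
  (mg : measurable_fun setT g) (mh : measurable_fun setT h)
  (h01 : forall y, 0 < h y <= 1).
Hypothesis ihD : P.-integrable setT
  (EFin \o (fun x => (U x - g (W x)) * h (W x))).
Hypothesis hD0 : forall B, measurable B ->
  (\int[P]_(x in W @^-1` B) ((U x - g (W x)) * h (W x))%:E = 0)%E.
Hypothesis U2 : P.-integrable setT (EFin \o (fun x => U x ^+ 2)).

Let mgW : measurable_fun setT (fun x => g (W x)).
Proof. exact: (measurableT_comp mg mW). Qed.

Let mhW : measurable_fun setT (fun x => h (W x)).
Proof. exact: (measurableT_comp mh mW). Qed.

(* Jensen's inequality, from [U^2 >= g^2 + 2 g (U - g)]; the extra weight
   [1 / (1 + |g|)] makes the cross term integrable. *)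
Lemma weighted_condE_sq_le :
  (\int[P]_x (g (W x) ^+ 2)%:E <= \int[P]_x (U x ^+ 2)%:E)%E.
Proof.
have h0 y : 0 < h y by case/andP : (h01 y).
have h1 y : h y <= 1 by case/andP : (h01 y).
have g1 y : 0 < 1 + `|g y| by rewrite ltr_pwDl.
have mg1 : measurable_fun setT (fun y => 1 + `|g y|).
  by apply: measurable_funD => //; exact: measurableT_comp.
pose r y := h y / (1 + `|g y|).
have r0 y : 0 < r y by rewrite divr_gt0.
have mr : measurable_fun setT r.
  by apply: measurable_funM => //; exact: measurable_funV.
have mrW : measurable_fun setT (fun x => r (W x)) := measurableT_comp mr mW.
have [mg2 mU2] : measurable_fun setT (fun x => g (W x) ^+ 2 * r (W x)) /\
    measurable_fun setT (fun x => U x ^+ 2 * r (W x)).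
  by split; apply: measurable_funM => //; exact: measurable_funX.
have key B : measurable B ->
    (\int[P]_(x in W @^-1` B) (g (W x) ^+ 2 * r (W x))%:E <=
     \int[P]_(x in W @^-1` B) (U x ^+ 2 * r (W x))%:E)%E.
  move=> mB; rewrite !integral_preimage.
  have m1B : measurable_fun setT (fun x => \1_B (W x) : R).
    by apply: measurableT_comp => //; exact: measurable_indic.
  (* Chosen so that [h * k] equals [2 g r \1_B]: the cross term of the expanded square becomes the
     weighted difference of [ihD] times a factor bounded by 2, and integrates to 0. *)
  pose k y := 2 * g y / (1 + `|g y|) * \1_B y.
  have mk : measurable_fun setT k.
    apply: measurable_funM; last exact: measurable_indic.
    by apply: measurable_funM; [exact: measurable_funM|exact: measurable_funV].
  have iDk : P.-integrable setT
      (EFin \o (fun x => (U x - g (W x)) * h (W x) * k (W x))).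
    apply: (@le_integrableR _ _ _ P _
      (fun x => 2 * ((U x - g (W x)) * h (W x)))).
    - apply: measurable_funM; last exact: measurableT_comp.
      by apply: measurable_funM => //; exact: measurable_funB.
    - move=> x; rewrite normrM [leRHS]normrM mulrC ler_wpM2r// /k normrM.
      rewrite -[leRHS]mulr1 ler_pM//; last first.
        by rewrite indicE; case: (_ \in _); rewrite ?normr1 ?normr0.
      rewrite normrM normfV (gtr0_norm (g1 _)) ler_pdivrMr// normrM ler_wpM2l//.
      by rewrite lerDr.
    - exact: (integrableZl measurableT 2 ihD).
  have iU : P.-integrable setT
      (EFin \o (fun x => U x ^+ 2 * r (W x) * \1_B (W x))).
    apply: le_integrableR U2; first exact: measurable_funM.
    move=> x; rewrite !normrM -mulrA ler_piMr//.
    rewrite -[leRHS]mulr1 ler_pM//; last first.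
      by rewrite indicE; case: (_ \in _); rewrite ?normr1 ?normr0.
    rewrite normfV (gtr0_norm (h0 _)) (gtr0_norm (g1 _)) ler_pdivrMr// mul1r.
    by rewrite (le_trans (h1 _))// lerDl.
  have z := integral_weight_eq0 mW mk ihD hD0 iDk.
  rewrite -[leRHS](@sube0 _) -z -integralB_EFin//.
  have ptw x : g (W x) ^+ 2 * r (W x) * \1_B (W x) <=
      U x ^+ 2 * r (W x) * \1_B (W x) - (U x - g (W x)) * h (W x) * k (W x).
    have -> : (U x - g (W x)) * h (W x) * k (W x) =
        2 * g (W x) * (U x - g (W x)) * (r (W x) * \1_B (W x)).
      by rewrite /k /r; ring.
    have w0 : 0 <= r (W x) * \1_B (W x) by exact: mulr_ge0 (ltW (r0 _)) _.
    rewrite -![_ * r (W x) * _]mulrA -mulrBl ler_wpM2r//.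
    rewrite -subr_ge0 (_ : _ - _ = (U x - g (W x)) ^+ 2) ?sqr_ge0//; ring.
  apply: ge0_le_integral => //.
  - move=> x _; rewrite lee_fin mulr_ge0// mulr_ge0 ?sqr_ge0// ltW//.
  - by apply/measurable_EFinP/measurable_funM.
  - apply/measurable_EFinP/measurable_funB; first exact: measurable_funM.
    by apply/measurable_EFinP; exact: measurable_int iDk.
  - by move=> x _; rewrite lee_fin.
have rK x : r (W x) * (r (W x))^-1 = 1 by rewrite divff ?gt_eqF.
have rE (f : T1 -> R) : (\int[P]_x (f x)%:E =
    \int[P]_x (f x * r (W x) * (r (W x))^-1)%:E)%E.
  by apply: eq_integral => x _; rewrite -mulrA rK mulr1.
(* The weight [r] is undone by the unbounded weight [1 / r]; all functions are nonnegative, so no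
   integrability is required. *)
rewrite rE [leRHS]rE.
apply: (ge0_le_integral_weight mW mg2 mU2 (measurable_funV mr r0) _ _ _ key).
- by move=> x; rewrite mulr_ge0 ?sqr_ge0 ?(ltW (r0 _)).
- by move=> x; rewrite mulr_ge0 ?sqr_ge0 ?(ltW (r0 _)).
- by move=> y; rewrite invr_ge0 (ltW (r0 _)).
Qed.

(** Jensen's inequality first makes [g(W)] square-integrable, hence integrable. Testing the weighted
    identity against [\1_B / h] then removes the weight. *)
Lemma weighted_condE_is_condE : sq_integrable P (g \o W) /\ is_condE P U W g.
Proof.
have g2 : sq_integrable P (g \o W).
  apply: sq_integrable_fin => //; apply: le_lt_trans weighted_condE_sq_le _.
  exact: integrable_lty.
split=> //.
have iU : P.-integrable setT (EFin \o U) by exact: sq_integrable_integrable.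
have ig := sq_integrable_integrable g2.
split => // B mB; rewrite !integral_preimage.
have m1B : measurable_fun setT (fun x => \1_B (W x) : R).
  by apply: measurableT_comp => //; exact: measurable_indic.
have i1 (f : T1 -> R) : P.-integrable setT (EFin \o f) ->
    P.-integrable setT (EFin \o (fun x => f x * \1_B (W x))).
  move=> fi; apply: (le_integrableR _ _ fi).
    apply: measurable_funM => //.
    by apply/measurable_EFinP; exact: measurable_int fi.
  move=> x; rewrite normrM ler_piMr// indicE.
  by case: (_ \in _); rewrite ?normr1 ?normr0.
have hK x : h (W x) * (\1_B (W x) / h (W x)) = \1_B (W x).
  by rewrite mulrC divfK// gt_eqF//; case/andP : (h01 (W x)).
have : (\int[P]_x (U x * \1_B (W x) - g (W x) * \1_B (W x))%:E = 0)%E.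
  transitivity (\int[P]_x ((U x - g (W x)) * h (W x) *
      (\1_B (W x) / h (W x)))%:E)%E.
    by apply: eq_integral => x _; rewrite -mulrA hK mulrBl.
  apply: (@integral_weight_eq0 _ _ _ _ _ P W _ (fun y => \1_B y / h y)
    mW _ ihD hD0).
  - apply: measurable_funM; first exact: measurable_indic.
    by apply: measurable_funV => // y; case/andP : (h01 y).
  - have := integrableB measurableT (i1 _ iU) (i1 _ ig).
    apply: eq_integrable => // x _ /=.
    by rewrite -mulrA hK mulrBl.
under eq_integral do rewrite EFinB.
rewrite integralB_EFin//; [|exact: i1|exact: (i1 _ ig)].
move=> /eqP; rewrite sube_eq ?add0e => [/eqP//| |].
- exact: (integrable_fin_num measurableT (i1 _ iU)).
- by rewrite fin_num_adde_defl// (integrable_fin_num measurableT (i1 _ ig)).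
Qed.

End weighted_condE.

Lemma is_condE_residual (d1 d2 : measure_display) (T1 : measurableType d1)
    (T2 : measurableType d2) (R : realType) (P : probability T1 R)
    (U : T1 -> R) (W : T1 -> T2) (g : T2 -> R) :
  measurable_fun setT W -> is_condE P U W g ->
  P.-integrable setT (EFin \o (fun t => U t - g (W t))) /\
  forall B, measurable B ->
    (\int[P]_(x in W @^-1` B) (U x - g (W x))%:E = 0)%E.
Proof.
move=> mW [mg iU ig UgE].
split; first exact: (integrableB measurableT iU ig).
move=> B mB; have mWB : measurable (W @^-1` B) by exact: measurable_preimage.
have iS f : P.-integrable setT (EFin \o f) ->
    P.-integrable (W @^-1` B) (EFin \o f).
  exact: integrableS.
under eq_integral do rewrite EFinB.
rewrite integralB_EFin//; [|exact: iS|exact: (iS _ ig)].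
by rewrite UgE// subee// (integrable_fin_num mWB (iS _ ig)).
Qed.

(** The case [h = 1] of the weighted statements: conditional expectation contracts the L2 norm. *)
Lemma is_condE_sq_integrable (d1 d2 : measure_display) (T1 : measurableType d1)
    (T2 : measurableType d2) (R : realType) (P : probability T1 R)
    (U : T1 -> R) (W : T1 -> T2) (g : T2 -> R) :
  measurable_fun setT W -> is_condE P U W g -> sq_integrable P U ->
  sq_integrable P (g \o W) /\
  (\int[P]_x (g (W x) ^+ 2)%:E <= \int[P]_x (U x ^+ 2)%:E)%E.
Proof.
move=> mW UWg [mU U2]; have [mg _ _ _] := UWg.
have [iD D0] := is_condE_residual mW UWg.
have m1 : measurable_fun setT (cst 1 : T2 -> R) by [].
have h1 (y : T2) : 0 < (1 : R) <= 1 by rewrite ltr01 lexx.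
have iD1 : P.-integrable setT (EFin \o (fun x => (U x - g (W x)) * 1)).
  by under eq_fun do rewrite mulr1.
have D1 B : measurable B ->
    (\int[P]_(x in W @^-1` B) ((U x - g (W x)) * 1)%:E = 0)%E.
  by move=> mB; under eq_integral do rewrite mulr1; exact: D0.
have [gi _] := weighted_condE_is_condE mU mW mg m1 h1 iD1 D1 U2.
by split=> //; exact: (weighted_condE_sq_le mU mW mg m1 h1 iD1 D1 U2).
Qed.

(** * Independence of disjoint blocks of an independent family *)

Definition indep2 (dT d1 d2 : measure_display) (T : measurableType dT)
    (T1 : measurableType d1) (T2 : measurableType d2) (R : realType)
    (P : probability T R) (X : T -> T1) (Y : T -> T2) : Prop :=
  forall B C, measurable B -> measurable C ->
    (P (X @^-1` B `&` Y @^-1` C) = P (X @^-1` B) * P (Y @^-1` C))%E.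

Section blocks.
Context (dT dS : measure_display) (T : measurableType dT)
  (S : measurableType dS) (R : realType) (P : probability T R).
Variables (I : finType) (W : I -> T -> S).
Hypothesis mW : forall i, measurable_fun setT (W i).
Hypothesis indW : mutually_independent P W.

(** A pi-system generating the sigma-algebra of the [W i] with [i] in [J]. Indexing by all of [I],
    with [setT] outside [J], lets the product rule apply to intersections of cylinders without
    reindexing. *)
Definition block_cylinders (J : {set I}) : set (set T) :=
  [set E | exists B : I -> set S,
    [/\ forall i, measurable (B i), forall i, i \notin J -> B i = setT &
        E = \bigcap_(i in [set: I]) (W i @^-1` B i)]].

Lemma block_cylinders_setI (J : {set I}) : setI_closed (block_cylinders J).
Proof.
move=> _ _ [B [mB BT ->]] [C [mC CT ->]].
exists (fun i => B i `&` C i); split => [i|i iJ|].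
- exact: measurableI.
- by rewrite BT// CT// setTI.
- by rewrite -bigcapI; apply: eq_bigcapr => i _; rewrite preimage_setI.
Qed.

Lemma block_cylinders_measurable (J : {set I}) :
  block_cylinders J `<=` measurable.
Proof.
move=> _ [B [mB _ ->]]; apply: fin_bigcap_measurable => // i _.
exact: measurable_preimage.
Qed.

Lemma block_cylinders_indep (J K : {set I}) (E F : set T) :
  (forall i, i \in J -> i \notin K) ->
  block_cylinders J E -> block_cylinders K F -> (P (E `&` F) = P E * P F)%E.
Proof.
move=> JK [B [mB BT ->]] [C [mC CT ->]].
rewrite -bigcapI.
under eq_bigcapr do rewrite -preimage_setI.
rewrite !indW//; last by move=> i; exact: measurableI.
rewrite -big_split/=; apply: eq_bigr => i _.
have [iJ|iJ] := boolP (i \in J).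
  by rewrite (CT i (JK i iJ)) setIT preimage_setT probability_setT mule1.
by rewrite (BT i iJ) setTI preimage_setT probability_setT mul1e.
Qed.

Let dynkin_indep (F : set T) : measurable F ->
  dynkin [set E | measurable E /\ (P (E `&` F) = P E * P F)%E].
Proof.
move=> mF; split => /=.
- by rewrite setTI probability_setT mul1e.
- move=> E [mE EF]; split; first exact: measurableC.
  have -> : ~` E `&` F = F `\` E by rewrite setIC setDE.
  rewrite measureD//; last by rewrite ltey_eq fin_num_measure.
  rewrite (setIC F) [X in (_ - X)%E]EF probability_setC//.
  by rewrite muleBl ?fin_num_measure ?mul1e.
- move=> G tG mG; split; first by apply: bigcupT_measurable => k; case: (mG k).
  rewrite setI_bigcupl measure_bigcup//; last 2 first.
  + by move=> k _; apply: measurableI => //; case: (mG k).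
  + exact: trivIset_setIr.
  rewrite measure_bigcup//; last by move=> k _; case: (mG k).
  rewrite muleC -(fineK (fin_num_measure P F mF)) -nneseriesZl//.
  apply: eq_eseriesr => k _; rewrite fineK ?fin_num_measure// muleC.
  by case: (mG k).
Qed.

(** Dynkin's argument is used twice: a cylinder of [J] is fixed while [F] ranges over the second
    sigma-algebra, then [F] is fixed while [E] ranges over the first. *)
Lemma block_sigma_indep (J K : {set I}) (E F : set T) :
  (forall i, i \in J -> i \notin K) ->
  <<s block_cylinders J >> E -> <<s block_cylinders K >> F ->
  (P (E `&` F) = P E * P F)%E.
Proof.
move=> JK sE sF.
have mF : measurable F.
  move: sF; apply: smallest_sub; first exact: sigma_algebra_measurable.
  exact: block_cylinders_measurable.
have cylF A : block_cylinders J A -> (P (A `&` F) = P A * P F)%E.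
  move=> JA; have mA := block_cylinders_measurable JA.
  move: sF; rewrite -setI_closed_g_dynkin_g_sigma_algebra; last first.
    exact: block_cylinders_setI.
  rewrite setIC muleC => sF.
  suff [] : [set E | measurable E /\ (P (E `&` A) = P E * P A)%E] F by [].
  move: F sF {mF}; apply: smallest_sub; first exact: dynkin_indep.
  move=> G KG; split; first exact: block_cylinders_measurable KG.
  by rewrite setIC muleC; exact: block_cylinders_indep JA KG.
move: sE; rewrite -setI_closed_g_dynkin_g_sigma_algebra; last first.
  exact: block_cylinders_setI.
move=> sE.
suff [] : [set E | measurable E /\ (P (E `&` F) = P E * P F)%E] E by [].
move: E sE; apply: smallest_sub; first exact: dynkin_indep.
by move=> G JG; split; [exact: block_cylinders_measurable JG|exact: cylF].
Qed.

(** Measurability from [g_sigma_algebraType] expresses that [X] depends only on the observations in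
    [J], without writing it as a function of them. *)
Lemma block_indep (d1 d2 : measure_display) (T1 : measurableType d1)
    (T2 : measurableType d2) (J K : {set I}) (X : T -> T1) (Y : T -> T2) :
  (forall i, i \in J -> i \notin K) ->
  measurable_fun setT (X : g_sigma_algebraType (block_cylinders J) -> T1) ->
  measurable_fun setT (Y : g_sigma_algebraType (block_cylinders K) -> T2) ->
  indep2 P X Y.
Proof.
move=> JK mX mY B C mB mC; apply: (block_sigma_indep JK).
- by have := mX measurableT _ mB; rewrite setTI.
- by have := mY measurableT _ mC; rewrite setTI.
Qed.

Lemma measurable_block (J : {set I}) (i : I) : i \in J ->
  measurable_fun setT (W i : g_sigma_algebraType (block_cylinders J) -> S).
Proof.
move=> iJ _ B mB; rewrite setTI; apply: sub_gen_smallest.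
exists (fun j => if j == i then B else setT); split.
- by move=> j; case: ifP.
- by move=> j jJ; case: eqP => // ji; move: jJ; rewrite ji iJ.
- apply/seteqP; split=> [x Bx j _ /=|x /(_ i Logic.I)/=]; last by rewrite eqxx.
  by case: eqP => [->|].
Qed.

End blocks.

(** * Fubini's theorem for independent variables *)

Section indep_fubini.
Context (dT d1 d2 : measure_display) (T : measurableType dT)
  (T1 : measurableType d1) (T2 : measurableType d2) (R : realType)
  (P : probability T R) (X : T -> T1) (Y : T -> T2).
Hypotheses (mX : measurable_fun setT X) (mY : measurable_fun setT Y).
Hypothesis XY : indep2 P X Y.

Let mfX : {mfun T >-> T1} := HB.pack X (isMeasurableFun.Build _ _ _ _ _ mX).
Let mfY : {mfun T >-> T2} := HB.pack Y (isMeasurableFun.Build _ _ _ _ _ mY).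
Let PX : probability T1 R := distribution P mfX.
Let PY : probability T2 R := distribution P mfY.
Let mXY : measurable_fun setT (fun t => (X t, Y t)).
Proof. exact: measurable_fun_pair. Qed.
Let mfXY : {mfun T >-> (T1 * T2)%type} :=
  HB.pack (fun t => (X t, Y t)) (isMeasurableFun.Build _ _ _ _ _ mXY).
Let PXY : probability (T1 * T2)%type R := distribution P mfXY.

Let joint_law (A : set (T1 * T2)) : measurable A -> (PX \x PY)%E A = PXY A.
Proof.
apply: product_measure_unique => B C mB mC.
by rewrite /PXY /distribution /pushforward/= -XY.
Qed.

Let ge0_integral_joint (F : T1 * T2 -> \bar R) : measurable_fun setT F ->
  (forall z, 0 <= F z)%E ->
  (\int[P]_t F (X t, Y t) = \int[PX \x PY]_z F z)%E.
Proof.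
move=> mF F0; rewrite (eq_measure_integral PXY); last first.
  by move=> A mA _; exact: joint_law.
by rewrite [RHS]ge0_integral_pushforward.
Qed.

Lemma indep_tonelli (F : T1 * T2 -> \bar R) : measurable_fun setT F ->
  (forall z, 0 <= F z)%E ->
  (\int[P]_t F (X t, Y t) = \int[P]_t \int[P]_s F (X s, Y t))%E.
Proof.
move=> mF F0; rewrite ge0_integral_joint// fubini_tonelli2//.
rewrite ge0_integral_pushforward//; last 2 first.
- exact: (measurable_fun_fubini_tonelli_G F mF).
- by move=> y _; exact: integral_ge0.
apply: eq_integral => t _ /=; rewrite /fubini_G ge0_integral_pushforward//.
by apply: (measurableT_comp mF) => //; exact: measurable_fun_pair.
Qed.

(** The freezing rule: [Y] is replaced by a constant and [X] is averaged out. *)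
Lemma indep_condE (F : T1 * T2 -> R) : measurable_fun setT F ->
  P.-integrable setT (fun t => (F (X t, Y t))%:E) ->
  is_condE P (fun t => F (X t, Y t)) Y
    (fun y => fine (\int[P]_s (F (X s, y))%:E)%E).
Proof.
move=> mF iF.
have mEF : measurable_fun setT (EFin \o F) by exact/measurable_EFinP.
have iF' : (PX \x PY)%E.-integrable setT (EFin \o F).
  apply/integrableP; split => //.
  rewrite -ge0_integral_joint//; first by case/integrableP : iF.
  exact: measurableT_comp.
have GE y : (fubini_G PX (EFin \o F) y = \int[P]_s (F (X s, y))%:E)%E.
  by rewrite /fubini_G integral_comp//; exact: measurableT_comp.
pose G := fubini_G PX (EFin \o F).
have mG : measurable_fun setT G by exact: (measurable_fubini_G iF').
have mAF : measurable_fun setT (abse \o (EFin \o F)) by exact: measurableT_comp.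
have iG : PY.-integrable setT G.
  apply/integrableP; split=> //.
  apply: le_lt_trans ((integrable21ltyP _ _ mEF).1 iF').
  apply: ge0_le_integral => //.
  - exact: measurableT_comp.
  - by apply: (measurable_fun_fubini_tonelli_G (abse \o (EFin \o F))) => //=.
  - move=> y _; apply: le_abse_integral => //.
    exact: measurableT_comp.
rewrite (_ : (fun y => fine _) = fine \o G); last first.
  by apply/funext => y /=; rewrite -GE.
have mg : measurable_fun setT (fine \o G) by exact: measurableT_comp.
have ig : PY.-integrable setT (EFin \o (fine \o G)).
  apply: le_integrable iG => //; first exact/measurable_EFinP.
  by move=> y _ /=; case: (G y) => [r| |] //=; rewrite normr0 leey.
have igY : P.-integrable setT (EFin \o ((fine \o G) \o Y)).
  have mEg : measurable_fun setT (EFin \o (fine \o G)) by exact/measurable_EFinP.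
  exact: (integrable_comp P mY mEg measurableT).1 ig.
split=> // B mB; rewrite !integral_preimage.
have m1 : measurable_fun setT (fun z : T1 * T2 => \1_B z.2 : R).
  by apply: measurableT_comp => //; exact: measurable_indic.
have mFB : measurable_fun setT (fun z : T1 * T2 => F z * \1_B z.2).
  exact: measurable_funM.
have iFB : (PX \x PY)%E.-integrable setT (EFin \o (fun z => F z * \1_B z.2)).
  apply: le_integrable iF' => //; first exact/measurable_EFinP.
  move=> z _ /=; rewrite lee_fin normrM ler_piMr// indicE.
  by case: (_ \in _); rewrite ?normr1 ?normr0.
transitivity (\int[PXY]_z (F z * \1_B z.2)%:E)%E.
  apply/esym/(integral_comp P mXY (f := fun z => (F z * \1_B z.2)%:E)).
  exact/measurable_EFinP.
transitivity (\int[PX \x PY]_z (F z * \1_B z.2)%:E)%E.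
  by apply/esym/eq_measure_integral => A mA _; exact: joint_law.
rewrite -(integral21_prod_meas1 iFB).
have mgB : measurable_fun setT (fun y => ((fine \o G) y * \1_B y)%:E).
  apply/measurable_EFinP/measurable_funM => //; exact: measurable_indic.
transitivity (\int[PY]_y ((fine \o G) y * \1_B y)%:E)%E; last first.
  exact: (integral_comp P mY mgB).
(* By Fubini's theorem the inner integral is finite for almost every [y], so [fine] changes it only
   on a null set. *)
apply: ae_eq_integral => //.
- exact: (measurable_fubini_G iFB).
- have := integrable_ae measurableT iG; apply: filterS => y /= /(_ I) Gy _.
  rewrite /fubini_G /= indicE; case: (y \in B); last first.
    by under eq_integral do rewrite mulr0; rewrite integral0 mulr0.
  by under eq_integral do rewrite mulr1; rewrite mulr1 fineK.
Qed.

End indep_fubini.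

(** The integral of a measurable function is infinite as soon as the function is not integrable, a
    difference of two infinite parts being infinite by convention; [fine] sends both infinities to
    0. *)
Lemma fine_integral_not_integrable (d : measure_display) (T : measurableType d)
    (R : realType) (P : probability T R) (f : T -> \bar R) :
  measurable_fun setT f -> ~ P.-integrable setT f ->
  fine (\int[P]_x f x)%E = 0.
Proof.
move=> mf nf; have : ~ ((\int[P]_x `|f x|)%E < +oo)%E.
  by move=> fi; apply: nf; apply/integrableP.
move=> /(abse_integralP P measurableT mf).
by case: (\int[P]_x f x)%E => [r| |]//=; rewrite ltry.
Qed.

Section indep_product.
Context (dT : measure_display) (T : measurableType dT) (R : realType)
  (P : probability T R) (U V : T -> R).
Hypotheses (mU : measurable_fun setT U) (mV : measurable_fun setT V).
Hypothesis UV : indep2 P U V.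

Let mE (f : T -> R) : measurable_fun setT f -> measurable_fun setT (EFin \o f).
Proof. by move=> mf; exact/measurable_EFinP. Qed.

(* Unconditional thanks to [fine], which sends a divergent integral to [0]. *)
Lemma indep_integralM :
  fine (\int[P]_t (U t * V t)%:E)%E =
  fine (\int[P]_t (U t)%:E)%E * fine (\int[P]_t (V t)%:E)%E.
Proof.
have mUV : measurable_fun setT (fun t => U t * V t) by exact: measurable_funM.
have [iUV|nUV] := pselect (P.-integrable setT (EFin \o (fun t => U t * V t))).
  have mF : measurable_fun setT (fun z : R * R => z.1 * z.2).
    by apply: measurable_funM.
  have [_ _ ig] := indep_condE mU mV UV mF iUV.
  move=> /(_ setT measurableT); rewrite preimage_setT /= => ->.
  have [iU|nU] := pselect (P.-integrable setT (EFin \o U)).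
    have gE y : fine (\int[P]_s (U s * y)%:E)%E = fine (\int[P]_t (U t)%:E)%E * y.
      under eq_integral do rewrite EFinM.
      rewrite integralZr// -(fineK (integrable_fin_num measurableT iU)).
      by rewrite -EFinM.
    under eq_integral do rewrite gE.
    have [->|c0] := eqVneq (fine (\int[P]_t (U t)%:E)%E) 0.
      by under eq_integral do rewrite mul0r; rewrite integral0 mul0r.
    (* The conditional expectation is here [E(U) * V], which is integrable; dividing by the nonzero
       [E(U)] gives the integrability of [V]. *)
    have iV : P.-integrable setT (EFin \o V).
      apply: eq_integrable (integrableZl measurableT
        (fine (\int[P]_t (U t)%:E)%E)^-1 ig) => // t _ /=.
      by rewrite gE -EFinM mulKf.
    under eq_integral do rewrite EFinM.
    rewrite integralZl// -[in LHS](fineK (integrable_fin_num measurableT iV)).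
    by rewrite -EFinM.
  rewrite [X in _ = X * _]fine_integral_not_integrable ?mul0r; [|exact: mE|by []].
  rewrite integral0_eq// => t _; congr (_%:E).
  have [->|y0] := eqVneq (V t) 0.
    by under eq_integral do rewrite mulr0; rewrite integral0.
  apply: fine_integral_not_integrable.
    by apply/measurable_EFinP; exact: measurable_funM.
  move=> iUy; apply: nU.
  apply: eq_integrable (integrableZr measurableT (V t)^-1 iUy) => // s _ /=.
  by rewrite -EFinM mulfK.
(* If both factors were integrable, Tonelli's theorem would make the product integrable too; so one
   factor is not, and the right-hand side is also 0. *)
rewrite fine_integral_not_integrable//; last exact: mE.
have [iU|nU] := pselect (P.-integrable setT (EFin \o U)); last first.
  by rewrite [X in _ = X * _]fine_integral_not_integrable ?mul0r//; exact: mE.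
have [iV|nV] := pselect (P.-integrable setT (EFin \o V)); last first.
  by rewrite [X in _ = _ * X]fine_integral_not_integrable ?mulr0//; exact: mE.
case: nUV; apply/integrableP; split; first exact: mE.
have mF : measurable_fun setT (fun z : R * R => `|z.1 * z.2|%:E).
  by apply/measurable_EFinP/measurableT_comp => //; exact: measurable_funM.
have -> : (\int[P]_t `|(U t * V t)%R%:E|)%E =
    (\int[P]_t \int[P]_s (`|U s * V t|%R)%:E)%E.
  by rewrite -(indep_tonelli mU mV UV mF).
have mnU := integrable_norm iU; have mnV := integrable_norm iV.
under eq_integral => t _.
  under eq_integral do rewrite normrM EFinM.
  rewrite (integralZr measurableT mnU) -(fineK (integrable_fin_num measurableT mnU)).
  over.
rewrite (integralZl measurableT mnV).
by rewrite -(fineK (integrable_fin_num measurableT mnV)) -EFinM ltry.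
Qed.

End indep_product.

(** Tonelli's theorem applied to the positive and negative parts avoids any integrability of the
    sections; this is what the pointwise bias of an arbitrary estimator requires. *)
Lemma measurable_fine_integral (dT d2 : measure_display) (T : measurableType dT)
    (T2 : measurableType d2) (R : realType) (P : probability T R)
    (F : T * T2 -> R) : measurable_fun setT F ->
  measurable_fun setT (fun y => fine (\int[P]_s (F (s, y))%:E)%E).
Proof.
move=> mF; apply: (measurableT_comp (f := fine)) => //.
have mE : measurable_fun setT (EFin \o F) by exact/measurable_EFinP.
rewrite (_ : (fun y => _) = (fun y => \int[P]_s (EFin \o F)^\+ (s, y) -
   \int[P]_s (EFin \o F)^\- (s, y))%E); last first.
  apply/funext => y; rewrite integralE; congr (_ - _)%E; apply: eq_integral => s _;
    by rewrite ?(funeposE, funenegE).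
apply: emeasurable_funB.
- apply: (measurable_fun_fubini_tonelli_G (EFin \o F)^\+%E) => //.
  exact: measurable_funepos.
- apply: (measurable_fun_fubini_tonelli_G (EFin \o F)^\-%E) => //.
  exact: measurable_funeneg.
Qed.

Lemma integral_law (dT dZ : measure_display) (T : measurableType dT)
    (TZ : measurableType dZ) (R : realType) (P : probability T R)
    (Q : probability TZ R) (Z : T -> TZ) (f : TZ -> \bar R) :
  measurable_fun setT Z -> (forall B, measurable B -> P (Z @^-1` B) = Q B) ->
  measurable_fun setT f -> (\int[P]_t f (Z t) = \int[Q]_z f z)%E.
Proof.
move=> mZ law mf; rewrite -(integral_comp P mZ mf).
by apply: eq_measure_integral => B mB _; exact: law.
Qed.

Lemma integrable_law (dT dZ : measure_display) (T : measurableType dT)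
    (TZ : measurableType dZ) (R : realType) (P : probability T R)
    (Q : probability TZ R) (Z : T -> TZ) (f : TZ -> \bar R) :
  measurable_fun setT Z -> (forall B, measurable B -> P (Z @^-1` B) = Q B) ->
  Q.-integrable setT f -> P.-integrable setT (f \o Z).
Proof.
move=> mZ law /integrableP[mf fi]; apply/integrableP; split.
  exact: measurableT_comp.
by rewrite (integral_law mZ law (f := abse \o f))//; exact: measurableT_comp.
Qed.

(** Conditioning on an independent [H] in addition to [X] keeps the residual centred: once [H] is
    frozen, an event in [(X, H)] becomes its section [Bt], an event in [X] alone. *)
Lemma indep_residual_integral0 (dT dZ dX d2 : measure_display)
    (T : measurableType dT) (TZ : measurableType dZ) (TX : measurableType dX)
    (T2 : measurableType d2) (R : realType) (P : probability T R)
    (Q : probability TZ R) (X : TZ -> TX) (a : TZ -> R)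
    (Z : T -> TZ) (H : T -> T2) :
  measurable_fun setT X -> Q.-integrable setT (EFin \o a) ->
  (forall B, measurable B -> (\int[Q]_(z in X @^-1` B) (a z)%:E = 0)%E) ->
  measurable_fun setT Z -> measurable_fun setT H ->
  (forall B, measurable B -> P (Z @^-1` B) = Q B) -> indep2 P Z H ->
  forall B : set (TX * T2), measurable B ->
  (\int[P]_(t in (fun t => (X (Z t), H t)) @^-1` B) (a (Z t))%:E = 0)%E.
Proof.
move=> mX ia a0 mZ mH law ZH B mB.
have ma : measurable_fun setT a.
  by apply/measurable_EFinP; exact: measurable_int ia.
have iaZ := integrable_law mZ law ia.
have maZ : measurable_fun setT (a \o Z) by exact: measurableT_comp.
have m1 : measurable_fun setT (\1_B : TX * T2 -> R) by exact: measurable_indic.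
have mXH : measurable_fun setT (fun zh : TZ * T2 => (X zh.1, zh.2)).
  by apply: measurable_fun_pair => //; exact: measurableT_comp.
pose F (zh : TZ * T2) : R := a zh.1 * \1_B (X zh.1, zh.2).
have mF : measurable_fun setT F.
  apply: measurable_funM; first exact: measurableT_comp.
  exact: (measurableT_comp m1 mXH).
have iF : P.-integrable setT (fun t => (F (Z t, H t))%:E).
  apply: (le_integrableR _ _ iaZ).
    by apply: (measurableT_comp mF); exact: measurable_fun_pair.
  move=> t; rewrite /F normrM ler_piMr// indicE.
  by case: (_ \in _); rewrite ?normr1 ?normr0.
rewrite integral_preimage.
have [_ _ _ /(_ setT measurableT)] := indep_condE mZ mH ZH mF iF.
rewrite preimage_setT => ->; apply: integral0_eq => t _; congr (_%:E).
rewrite (_ : integral _ _ _ = 0%E)//.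
pose Bt := (fun x => (x, H t)) @^-1` B.
have mBt : measurable Bt.
  by apply: measurable_preimage => //; exact: measurable_fun_pair.
rewrite -[RHS](a0 _ mBt) integral_preimage.
rewrite -(integral_law mZ law (f := fun z => (a z * \1_Bt (X z))%:E)).
  apply: eq_integral => s _; rewrite /F /= !indicE.
  suff -> : (X (Z s) \in Bt) = ((X (Z s), H t) \in B) by [].
  by apply/idP/idP; rewrite !inE.
apply/measurable_EFinP/measurable_funM => //.
by apply: measurableT_comp => //; exact: measurable_indic.
Qed.

(** * Conditional expectation of the error of a product *)

Section product_condE.
Context (d1 d2 : measure_display) (T1 : measurableType d1)
  (T2 : measurableType d2) (R : realType) (P : probability T1 R).
Variables (K : T1 -> T2) (u v : T2 -> R) (a y : T1 -> R).
Hypotheses (mK : measurable_fun setT K) (mu : measurable_fun setT u)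
  (mv : measurable_fun setT v).
Hypotheses (ia : P.-integrable setT (EFin \o a))
  (iy : P.-integrable setT (EFin \o y)).
Hypothesis a0 : forall B, measurable B ->
  (\int[P]_(x in K @^-1` B) (a x)%:E = 0)%E.
Hypothesis y0 : forall B, measurable B ->
  (\int[P]_(x in K @^-1` B) (y x)%:E = 0)%E.
Let w t := (a t - u (K t)) * (y t - v (K t)) - a t * y t.
Hypothesis w2 : sq_integrable P w.

(** In [w - u v] the product [a y], whose integrability is not assumed, cancels, and what remains is
    linear in [a] and [y]. The coefficients [u h] and [v h] are bounded by 1, so both weighted terms
    are integrable and integrate to 0 over the events of [K]. *)
Lemma product_condE : sq_integrable P ((u \* v) \o K) /\ is_condE P w K (u \* v).
Proof.
pose q k := (1 + u k ^+ 2) * (1 + v k ^+ 2).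
have q1 k : 1 <= q k.
  by rewrite -[1]mulr1 ler_pM// lerDl sqr_ge0.
have q0 k : 0 < q k by exact: lt_le_trans (q1 k).
have mq : measurable_fun setT q.
  by apply: measurable_funM; apply: measurable_funD => //; exact: measurable_funX.
pose h k := (q k)^-1.
have mh : measurable_fun setT h by exact: (measurable_funV mq q0).
have h0 k : 0 < h k by rewrite invr_gt0.
have h01 k : 0 < h k <= 1 by rewrite h0/= /h invf_le1.
have ma : measurable_fun setT a.
  by apply/measurable_EFinP; exact: measurable_int ia.
have my : measurable_fun setT y.
  by apply/measurable_EFinP; exact: measurable_int iy.
have bnd (b : T1 -> R) (k : T2 -> R) :
    measurable_fun setT b -> measurable_fun setT k ->
    P.-integrable setT (EFin \o b) -> (forall z, `|k z| <= 1) ->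
    P.-integrable setT (EFin \o (fun x => b x * k (K x))).
  move=> mb mk ib k1; apply: (le_integrableR _ _ ib).
    by apply: measurable_funM => //; exact: measurableT_comp.
  by move=> x; rewrite normrM ler_piMr.
have sq1 (r s : R) : `|r / ((1 + r ^+ 2) * (1 + s ^+ 2))| <= 1.
  have r1 : 0 < 1 + r ^+ 2 by rewrite ltr_pwDl// sqr_ge0.
  have s1 : 0 < 1 + s ^+ 2 by rewrite ltr_pwDl// sqr_ge0.
  rewrite normrM normfV ler_pdivrMr ?normr_gt0 ?gt_eqF ?mulr_gt0// mul1r.
  rewrite (gtr0_norm (mulr_gt0 r1 s1)).
  have rr : `|r| <= 1 + r ^+ 2.
    rewrite -(real_normK (num_real r)).
    by have := sqr_ge0 (`|r| - 1); have := normr_ge0 r; rewrite !expr2; nra.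
  by rewrite (le_trans rr)// ler_peMr ?(ltW r1)// lerDl sqr_ge0.
have uh k : `|u k * h k| <= 1 by exact: sq1.
have vh k : `|v k * h k| <= 1 by rewrite /h /q [X in _ / X]mulrC; exact: sq1.
have DE t : (w t - (u \* v) (K t)) * h (K t) =
    - (a t * (v (K t) * h (K t)) + y t * (u (K t) * h (K t))).
  by rewrite /w /=; ring.
have iav := bnd _ (fun k => v k * h k) ma (measurable_funM mv mh) ia vh.
have iyu := bnd _ (fun k => u k * h k) my (measurable_funM mu mh) iy uh.
have iD : P.-integrable setT
    (EFin \o (fun x => (w x - (u \* v) (K x)) * h (K x))).
  have := integrableN (integrableD measurableT iav iyu).
  by apply: eq_integrable => // t _ /=; rewrite DE.
have [mw w2'] := w2.
apply: (weighted_condE_is_condE mw mK (measurable_funM mu mv) mh h01 iD _ w2').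
move=> B mB; rewrite integral_preimage.
have m1 : measurable_fun setT (\1_B : T2 -> R) by exact: measurable_indic.
have ind k : `|\1_B k| <= 1 :> R.
  by rewrite indicE; case: (_ \in _); rewrite ?normr1 ?normr0.
have zero (b : T1 -> R) (k : T2 -> R) :
    measurable_fun setT b -> measurable_fun setT k ->
    P.-integrable setT (EFin \o b) -> (forall z, `|k z| <= 1) ->
    (forall B, measurable B -> (\int[P]_(x in K @^-1` B) (b x)%:E = 0)%E) ->
    P.-integrable setT (EFin \o (fun x => b x * (k (K x) * \1_B (K x)))) /\
    (\int[P]_x (b x * (k (K x) * \1_B (K x)))%:E = 0)%E.
  move=> mb mk ib k1 b0.
  have mkB : measurable_fun setT (fun z => k z * \1_B z) by exact: measurable_funM.
  have i1 : P.-integrable setT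
      (EFin \o (fun x => b x * (k (K x) * \1_B (K x)))).
    apply: (bnd b (fun z => k z * \1_B z)) => // z.
    by rewrite normrM -[1]mulr1 ler_pM.
  split => //.
  exact: (integral_weight_eq0 (k := fun z => k z * \1_B z) mK mkB ib b0 i1).
have [i1 e1] := zero a (fun k => v k * h k) ma (measurable_funM mv mh) ia vh a0.
have [i2 e2] := zero y (fun k => u k * h k) my (measurable_funM mu mh) iy uh y0.
transitivity (\int[P]_x ((-1)%:E * ((a x * (v (K x) * h (K x) * \1_B (K x)))%:E +
    (y x * (u (K x) * h (K x) * \1_B (K x)))%:E)))%E.
  apply: eq_integral => x _; rewrite -EFinD -EFinM DE; congr (_%:E); ring.
rewrite (integralZl measurableT (integrableD measurableT i1 i2)).
by rewrite integralD// e1 e2 adde0 mule0.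
Qed.

End product_condE.

(** * Second moments and Chebyshev's inequality *)

Section second_moment.
Context (d : measure_display) (T : measurableType d) (R : realType)
  (P : probability T R).
Implicit Types f g : T -> R.

Lemma Rintegral_sum (I : Type) (s : seq I) (f : I -> T -> R) :
  (forall i, P.-integrable setT (EFin \o f i)) ->
  \int[P]_x (\sum_(i <- s) f i x) = \sum_(i <- s) \int[P]_x f i x.
Proof.
move=> fi; elim: s => [|i s IH].
  rewrite big_nil; under eq_Rintegral do rewrite big_nil.
  by rewrite Rintegral_cst// mul0r.
rewrite big_cons -IH -RintegralD//.
  by apply: eq_Rintegral => x _; rewrite big_cons.
have := @integrable_sum _ _ _ P setT measurableT _ s xpredT (fun i => EFin \o f i)
  (fun j _ => fi j).
by apply: eq_integrable => // x _; rewrite /= sumEFin.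
Qed.

Lemma Rintegral_sqr_sum n (f : 'I_n -> T -> R) :
  (forall i, sq_integrable P (f i)) ->
  \int[P]_x (\sum_i f i x) ^+ 2 = \sum_i \sum_j \int[P]_x (f i x * f j x).
Proof.
move=> hf.
transitivity (\int[P]_x (\sum_i \sum_j f i x * f j x)).
  apply: eq_Rintegral => x _; rewrite expr2 mulr_suml.
  by apply: eq_bigr => i _; rewrite mulr_sumr.
rewrite Rintegral_sum.
  by apply: eq_bigr => i _; rewrite Rintegral_sum// => j; exact: sq_integrableM.
move=> i; have := sq_integrableM (hf i) (sq_integrable_sum (index_enum 'I_n) hf).
by apply: eq_integrable => // x _ /=; rewrite mulr_sumr.
Qed.

Lemma Rintegral_sqr_sum_orthogonal n (f : 'I_n -> T -> R) :
  (forall i, sq_integrable P (f i)) ->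
  (forall i j, i != j -> \int[P]_x (f i x * f j x) = 0) ->
  \int[P]_x (\sum_i f i x) ^+ 2 = \sum_i \int[P]_x (f i x ^+ 2).
Proof.
move=> hf of_; rewrite Rintegral_sqr_sum//; apply: eq_bigr => i _.
rewrite (bigD1 i)//= big1 ?addr0; last by move=> j ji; rewrite of_// eq_sym.
by apply: eq_Rintegral => x _; rewrite expr2.
Qed.

Lemma Rintegral_sqrB_le f g (M : R) : sq_integrable P f -> sq_integrable P g ->
  \int[P]_x (f x ^+ 2) <= M -> \int[P]_x (g x ^+ 2) <= M ->
  \int[P]_x ((f x - g x) ^+ 2) <= 4 * M.
Proof.
move=> hf hg fM gM; have [_ if2] := hf; have [_ ig2] := hg.
have [_ ifg2] := sq_integrableB hf hg.
have i2 h : P.-integrable setT (EFin \o h) ->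
    P.-integrable setT (EFin \o (fun x => 2 * h x)).
  by move=> ih; exact: (integrableZl measurableT 2 ih).
apply: (@le_trans _ _ (\int[P]_x (2 * f x ^+ 2 + 2 * g x ^+ 2))).
  apply: le_Rintegral => //.
    exact: (integrableD measurableT (i2 _ if2) (i2 _ ig2)).
  by move=> x _; have := sqr_ge0 (f x + g x); rewrite !expr2; lra.
rewrite RintegralD//; [|exact: (i2 _ if2)|exact: (i2 _ ig2)].
by rewrite !RintegralZl//; lra.
Qed.

(** Chebyshev's inequality at the threshold whose square is [C / e * V], for which the bound on the
    probability is exactly [e]. *)
Lemma tail_bound f (C V e : R) : sq_integrable P f -> 0 < C -> 0 <= V ->
  0 < e -> \int[P]_x (f x ^+ 2) <= C * V ->
  (P [set x | (Num.sqrt (C / e) * Num.sqrt V < `|f x|)%R] <= e%:E)%E.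
Proof.
move=> [mf if2] C0 V0 e0 fV.
have mf2 : measurable_fun setT (EFin \o (fun x => f x ^+ 2)).
  exact: measurable_int if2.
have Ce0 : 0 < C / e by rewrite divr_gt0.
have f2E : (\int[P]_x (f x ^+ 2)%:E = (\int[P]_x (f x ^+ 2))%:E)%E.
  by rewrite /Rintegral fineK// (integrable_fin_num measurableT if2).
have mS c : measurable [set x | c < `|f x|].
  rewrite -[X in measurable X]setTI.
  have mnf : measurable_fun setT (fun x => `|f x|) by exact: measurableT_comp.
  have := mnf measurableT `]c, +oo[%classic.
  rewrite (_ : _ @^-1` _ = [set x | c < `|f x|]).
    by apply; exact: measurable_itv.
  by apply/seteqP; split=> x /=; rewrite in_itv/= andbT.
(* At [V = 0] the threshold is 0 and Chebyshev's inequality is void, but then [f] vanishes almost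
   everywhere. *)
have [V00|Vn0] := eqVneq V 0.
  have f2_0 : (\int[P]_x `|(f x ^+ 2)%:E| = 0)%E.
    under eq_integral do rewrite gee0_abs ?lee_fin ?sqr_ge0//.
    rewrite f2E; congr (_%:E); apply/eqP; rewrite eq_le; apply/andP; split.
      by rewrite (le_trans fV)// V00 mulr0.
    by apply: Rintegral_ge0 => x _; exact: sqr_ge0.
  have [N [mN N0 sN]] := (ae_eq_integral_abs P measurableT mf2).1 f2_0.
  apply: (@le_trans _ _ 0%E); last by rewrite lee_fin ltW.
  rewrite V00 sqrtr0 mulr0 -N0; apply: le_measure; rewrite ?inE//.
  move=> x /= fx; apply: sN => /= /(_ I) [/eqP].
  by rewrite sqrf_eq0 -normr_eq0 gt_eqF.
have Vp : 0 < V by rewrite lt0r Vn0.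
have a0 : 0 < C / e * V by rewrite mulr_gt0.
have := le_integral_abse P measurableT mf2 a0.
under eq_integral do rewrite /= ger0_norm ?sqr_ge0//.
rewrite f2E setTI => h.
have {h} : ((C / e * V)%:E *
    P [set x | (Num.sqrt (C / e) * Num.sqrt V < `|f x|)%R]
    <= (C * V)%:E)%E.
  apply: le_trans (le_trans h _); last by rewrite lee_fin.
  rewrite lee_pmul2l ?lte_fin// ?fin_numE//.
  apply: le_measure; rewrite ?inE//.
    rewrite -[X in measurable X]setTI.
    apply: emeasurable_fun_c_infty => //.
    by apply: measurableT_comp.
  move=> x /=; rewrite -sqrtrM ?(ltW Ce0)// => fx.
  rewrite lee_fin (ger0_norm (sqr_ge0 _)) -(real_normK (num_real (f x))).
  rewrite -(sqr_sqrtr (ltW a0)) ler_pXn2r ?nnegrE ?sqrtr_ge0//; exact: ltW.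
rewrite (_ : C * V = C / e * V * e); last by field; rewrite gt_eqF.
by rewrite [X in (_ <= X)%E]EFinM lee_pmul2l ?lte_fin// ?fin_numE.
Qed.

(** Origin of 24: the square of a sum of three terms costs a factor 3, and the squares of [w - b]
    and of [k - m] have integral at most [4 M] each, which gives [24 M + 3 rho]. *)
Lemma second_moment_bound n (w b k : 'I_n -> T -> R) (m M rho : R) :
  (0 < n)%N -> 0 <= M -> 0 <= rho ->
  (forall i, sq_integrable P (w i)) -> (forall i, sq_integrable P (b i)) ->
  (forall i, sq_integrable P (k i)) ->
  (forall i, \int[P]_x (w i x ^+ 2) <= M) ->
  (forall i, \int[P]_x (b i x ^+ 2) <= M) ->
  (forall i, \int[P]_x (k i x ^+ 2) <= M) -> m ^+ 2 <= M ->
  (forall i j, i != j ->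
    \int[P]_x ((w i x - b i x) * (w j x - b j x)) = 0) ->
  (forall i j, i != j -> \int[P]_x ((k i x - m) * (k j x - m)) = 0) ->
  \sum_i \sum_j \int[P]_x ((b i x - k i x) * (b j x - k j x)) <= n%:R * rho ->
  \int[P]_x ((n%:R^-1 * (\sum_i w i x) - m) ^+ 2) <= 24 * ((M + rho) / n%:R).
Proof.
move=> n0 M0 rho0 hw hb hk wM bM kM mM owb okm brho.
have nR0 : 0 < n%:R :> R by rewrite ltr0n.
pose D i x := w i x - b i x; pose C i x := b i x - k i x; pose H i x := k i x - m.
have hD i : sq_integrable P (D i) by exact: sq_integrableB.
have hC i : sq_integrable P (C i) by exact: sq_integrableB.
have hm : sq_integrable P (cst m) by exact: sq_integrable_cst.
have hH i : sq_integrable P (H i) by exact: (sq_integrableB (hk i) hm).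
pose SD x := \sum_i D i x; pose SC x := \sum_i C i x; pose SH x := \sum_i H i x.
have hSD : sq_integrable P SD by exact: sq_integrable_sum.
have hSC : sq_integrable P SC by exact: sq_integrable_sum.
have hSH : sq_integrable P SH by exact: sq_integrable_sum.
have eD : \int[P]_x (SD x ^+ 2) <= n%:R * (4 * M).
  rewrite Rintegral_sqr_sum_orthogonal//.
  apply: le_trans (ler_sum _ (fun i _ =>
    Rintegral_sqrB_le (hw i) (hb i) (wM i) (bM i))) _.
  by rewrite sumr_const card_ord -[_ *+ n]mulr_natl.
have eH : \int[P]_x (SH x ^+ 2) <= n%:R * (4 * M).
  rewrite Rintegral_sqr_sum_orthogonal//.
  have mM' : \int[P]_x (cst m x ^+ 2) <= M.
    by rewrite /= Rintegral_cst// [X in fine X]probability_setT mulr1.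
  apply: le_trans (ler_sum _ (fun i _ =>
    Rintegral_sqrB_le (hk i) hm (kM i) mM')) _.
  by rewrite sumr_const card_ord -[_ *+ n]mulr_natl.
have eC : \int[P]_x (SC x ^+ 2) <= n%:R * rho by rewrite Rintegral_sqr_sum.
have eqR x : n%:R^-1 * (\sum_i w i x) - m = n%:R^-1 * (SD x + SC x + SH x).
  rewrite /SD /SC /SH -!big_split/=.
  have DCH i : D i x + C i x + H i x = w i x - m by rewrite /D /C /H; ring.
  under [in RHS]eq_bigr => i _ do rewrite DCH.
  by rewrite sumrB sumr_const card_ord mulrBr -[m *+ n]mulr_natl mulKf ?gt_eqF.
have [_ iSD] := hSD; have [_ iSC] := hSC; have [_ iSH] := hSH.
apply: (@le_trans _ _ (\int[P]_x
  (3 / n%:R ^+ 2 * (SD x ^+ 2 + SC x ^+ 2 + SH x ^+ 2)))).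
  have hR := sq_integrableZ n%:R^-1 (sq_integrableD (sq_integrableD hSD hSC) hSH).
  apply: le_Rintegral => //.
  - have [_] := hR; apply: eq_integrable => // x _ /=.
    by rewrite eqR.
  - exact: (integrableZl measurableT _ (integrableD measurableT
      (integrableD measurableT iSD iSC) iSH)).
  - move=> x _; rewrite eqR exprMn exprVn [3 / _]mulrC -mulrA.
    rewrite ler_wpM2l ?invr_ge0 ?sqr_ge0//.
    have := sqr_ge0 (SD x - SC x); have := sqr_ge0 (SD x - SH x);
    have := sqr_ge0 (SC x - SH x); rewrite !expr2; lra.
rewrite RintegralZl//; last first.
  exact: (integrableD measurableT (integrableD measurableT iSD iSC) iSH).
rewrite RintegralD//; last exact: (integrableD measurableT iSD iSC).
rewrite RintegralD//.
apply: (@le_trans _ _ (3 / n%:R ^+ 2 *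
  (n%:R * (4 * M) + n%:R * rho + n%:R * (4 * M)))).
  by rewrite ler_wpM2l ?divr_ge0 ?sqr_ge0// !lerD.
rewrite (_ : 3 / _ * _ = (24 * M + 3 * rho) / n%:R); last by field; rewrite gt_eqF.
by rewrite mulrA ler_wpM2r ?invr_ge0 ?(ltW nR0)//; lra.
Qed.

End second_moment.

(** * Functions of an observation *)

Lemma norm2_sqr (R : realType) (d : nat) (PZ : probability (obs R d) R)
    (g : obs R d -> R) :
  (norm2 PZ g ^+ 2 = \int[PZ]_z (g z ^+ 2)%:E)%E.
Proof.
have pow2 (x : \bar R) : (0 <= x)%E -> (x ^+ 2 = x `^ 2%:R)%E.
  case: x => [r| |]// r0; last by rewrite poweRyr ?pnatr_eq0// expe2 mulyy.
  by rewrite poweR_EFin powR_mulrn -?lee_fin.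
rewrite pow2; last exact: Lnorm_ge0.
rewrite powR_Lnorm ?pnatr_eq0//; apply: eq_integral => z _.
by rewrite -pow2 ?abse_ge0// [LHS]/= -EFinM -expr2 real_normK ?num_real.
Qed.

Lemma measurable_mktuple (d1 d2 : measure_display) (T1 : measurableType d1)
    (T2 : measurableType d2) (n : nat) (D : 'I_n -> T1 -> T2) :
  (forall i, measurable_fun setT (D i)) ->
  measurable_fun setT (fun t => [tuple D i t | i < n]).
Proof.
move=> mD; apply/measurable_fun_tnthP => i.
rewrite (_ : _ \o _ = D i)//; apply/funext => t /=.
by rewrite tnth_mktuple.
Qed.

Section obs.
Context (R : realType) (d : nat) (PZ : probability (obs R d) R).

Lemma measurable_obsX : measurable_fun setT (@obsX R d).
Proof. exact: measurableT_comp. Qed.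

Lemma measurable_obsA : measurable_fun setT (@obsA R d).
Proof. exact: measurableT_comp. Qed.

Lemma measurable_obsY : measurable_fun setT (@obsY R d).
Proof. exact: measurable_snd. Qed.

Lemma measurable_phi (p m : d.-tuple R -> R) : measurable_fun setT p ->
  measurable_fun setT m -> measurable_fun setT (phi p m).
Proof.
move=> mp mm; apply: measurable_funM; apply: measurable_funB.
- exact: measurable_obsA.
- exact: measurableT_comp mp measurable_obsX.
- exact: measurable_obsY.
- exact: measurableT_comp mm measurable_obsX.
Qed.

(** The tower property: [condCov] of [A] and [Y] unfolds to the conditional expectation of [phi0],
    which is tested on the whole space. *)
Lemma psi_eccE : PZ.-integrable setT (EFin \o @obsA R d) ->
  PZ.-integrable setT (EFin \o @obsY R d) ->
  psi_ecc PZ = fine 'E_PZ[phi0 PZ].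
Proof.
move=> iA iY; rewrite /psi_ecc !unlock.
have [mpi _ _ _] := condEP measurable_obsX iA.
have [mmu _ _ _] := condEP measurable_obsX iY.
have mphi0 := measurable_phi mpi mmu.
(* If [phi0] is not integrable, both sides take their default value [0]. *)
have [i0|n0] := pselect (PZ.-integrable setT (EFin \o phi0 PZ)).
  have [_ _ _ /(_ setT measurableT)] := condEP measurable_obsX i0.
  by rewrite preimage_setT => <-.
rewrite [RHS]fine_integral_not_integrable//; last exact/measurable_EFinP.
rewrite /condCov /condE; case: xgetP => [g _ [_ i0 _ _]|_].
  by case: n0.
by rewrite integral0.
Qed.

End obs.

(** * Independence between and within the three samples *)

Section samples.
Context (R : realType) (d : nat) (PZ : probability (obs R d) R)
  (dT : measure_display) (T : measurableType dT) (P : probability T R)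
  (n : nat) (Dpi Dmu Dphi : 'I_n -> T -> obs R d).
Hypothesis hiid : iid_copies P PZ (join3 Dpi Dmu Dphi).

Let W := join3 Dpi Dmu Dphi.
Let mW k : measurable_fun setT (W k). Proof. by case: hiid. Qed.
Let indW : mutually_independent P W. Proof. by case: hiid. Qed.
Let law k B : measurable B -> P (W k @^-1` B) = PZ B.
Proof. by case: hiid => _ + _ mB => ->. Qed.

Let idx := ('I_n + 'I_n + 'I_n)%type.
Let Ipi : {set idx} :=
  finset.finset (fun k : idx => if k is inl (inl _) then true else false).
Let Imu : {set idx} :=
  finset.finset (fun k : idx => if k is inl (inr _) then true else false).
Let Itr : {set idx} :=
  finset.finset (fun k : idx => if k is inl _ then true else false).
Let Iphi : {set idx} :=
  finset.finset (fun k : idx => if k is inr _ then true else false).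
Let Iz (i : 'I_n) : {set idx} := finset.finset (fun k : idx => k == inr i).
Let Itrz (i : 'I_n) : {set idx} := finset.setU Itr (Iz i).

Local Notation block J := (g_sigma_algebraType (block_cylinders W J)).

Let mblock (J : {set idx}) k : k \in J ->
  measurable_fun setT (W k : block J -> obs R d).
Proof. exact: measurable_block. Qed.

Let mpi_block (J : {set idx}) : (forall i, inl (inl i) \in J) ->
  measurable_fun setT
    (sample Dpi : block J -> n.-tuple (obs R d)).
Proof.
by move=> iJ; apply: measurable_mktuple => i; exact: (mblock (iJ i)).
Qed.

Let mmu_block (J : {set idx}) : (forall i, inl (inr i) \in J) ->
  measurable_fun setT
    (sample Dmu : block J -> n.-tuple (obs R d)).
Proof.
by move=> iJ; apply: measurable_mktuple => i; exact: (mblock (iJ i)).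
Qed.

Definition training t := (sample Dpi t, sample Dmu t).

Let mtr_block (J : {set idx}) : (forall i, inl i \in J) ->
  measurable_fun setT
    (training : block J -> (n.-tuple (obs R d) * n.-tuple (obs R d))%type).
Proof.
by move=> iJ; apply: measurable_fun_pair; [exact: mpi_block|exact: mmu_block].
Qed.

Lemma measurable_Dphi i : measurable_fun setT (Dphi i).
Proof. exact: (mW (inr i)). Qed.

Lemma measurable_sample_pi : measurable_fun setT (sample Dpi).
Proof. by apply: measurable_mktuple => i; exact: (mW (inl (inl i))). Qed.

Lemma measurable_sample_mu : measurable_fun setT (sample Dmu).
Proof. by apply: measurable_mktuple => i; exact: (mW (inl (inr i))). Qed.

Lemma measurable_training : measurable_fun setT training.
Proof.
apply: measurable_fun_pair; first exact: measurable_sample_pi.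
exact: measurable_sample_mu.
Qed.

Lemma measurable_sampleX : measurable_fun setT (sampleX Dphi).
Proof.
apply: measurable_mktuple => i.
by apply: measurableT_comp; [exact: measurable_obsX|exact: measurable_Dphi].
Qed.

Lemma law_Dphi i B : measurable B -> P (Dphi i @^-1` B) = PZ B.
Proof. exact: (law (inr i)). Qed.

Lemma indep_Dphi_training i : indep2 P (Dphi i) training.
Proof.
apply: (block_indep mW indW (J := Iz i) (K := Itr)).
- by move=> [k|k]; rewrite !finset.inE.
- by apply: (mblock (k := inr i)); rewrite finset.inE.
- by apply: mtr_block => k; rewrite finset.inE.
Qed.

Lemma indep_Dphi_training_Dphi i j : i != j ->
  indep2 P (Dphi i) (fun t => (training t, Dphi j t)).
Proof.
move=> ij; apply: (block_indep mW indW (J := Iz i) (K := Itrz j)).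
- by move=> [k|k]; rewrite !finset.inE// => /eqP[->].
- by apply: (mblock (k := inr i)); rewrite finset.inE.
- apply: measurable_fun_pair; last first.
    by apply: (mblock (k := inr j)); rewrite !finset.inE eqxx orbT.
  by apply: mtr_block => k; rewrite !finset.inE.
Qed.

Lemma indep_training_sampleX : indep2 P training (sampleX Dphi).
Proof.
apply: (block_indep mW indW (J := Itr) (K := Iphi)).
- by move=> [k|k]; rewrite !finset.inE.
- by apply: mtr_block => k; rewrite finset.inE.
- apply: measurable_mktuple => i.
  apply: (measurableT_comp (@measurable_obsX R d)).
  by apply: (mblock (k := inr i)); rewrite finset.inE.
Qed.

Lemma indep_obsX_obsX i j : i != j ->
  indep2 P (fun t => obsX (Dphi i t)) (fun t => obsX (Dphi j t)).
Proof.
move=> ij; apply: (block_indep mW indW (J := Iz i) (K := Iz j)).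
- by move=> [k|k]; rewrite !finset.inE// => /eqP[->].
- apply: (measurableT_comp (@measurable_obsX R d)).
  by apply: (mblock (k := inr i)); rewrite finset.inE.
- apply: (measurableT_comp (@measurable_obsX R d)).
  by apply: (mblock (k := inr j)); rewrite finset.inE.
Qed.

Lemma indep_samples : indep2 P (sample Dpi) (sample Dmu).
Proof.
apply: (block_indep mW indW (J := Ipi) (K := Imu)).
- by move=> [[k|k]|k]; rewrite !finset.inE.
- by apply: mpi_block => k; rewrite finset.inE.
- by apply: mmu_block => k; rewrite finset.inE.
Qed.

End samples.

Lemma indep2_comp (dT d1 d2 d1' d2' : measure_display) (T : measurableType dT)
    (T1 : measurableType d1) (T2 : measurableType d2)
    (T1' : measurableType d1') (T2' : measurableType d2') (R : realType)
    (P : probability T R) (X : T -> T1) (Y : T -> T2) (f : T1 -> T1')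
    (g : T2 -> T2') : measurable_fun setT f -> measurable_fun setT g ->
  indep2 P X Y -> indep2 P (f \o X) (g \o Y).
Proof.
move=> mf mg XY B C mB mC.
by apply: (XY (f @^-1` B) (g @^-1` C)); exact: measurable_preimage.
Qed.

Lemma is_condE_coarser (d1 d2 d3 : measure_display) (T1 : measurableType d1)
    (T2 : measurableType d2) (T3 : measurableType d3) (R : realType)
    (P : probability T1 R) (U : T1 -> R) (W : T1 -> T2) (s : T2 -> T3)
    (g : T3 -> R) : measurable_fun setT s -> measurable_fun setT g ->
  is_condE P U W (g \o s) -> is_condE P U (s \o W) g.
Proof.
move=> ms mg [_ iU ig UgE]; split => // B mB.
by apply: (UgE (s @^-1` B)); exact: measurable_preimage.
Qed.

Lemma measurable_estimator_comp (R : realType) (d n : nat)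
    (etahat : estimator R d) (d1 : measure_display) (T1 : measurableType d1)
    (s : T1 -> n.-tuple (obs R d)) (x : T1 -> d.-tuple R) :
  measurable_estimator etahat -> measurable_fun setT s -> measurable_fun setT x ->
  measurable_fun setT (fun t => @etahat n (s t) (x t)).
Proof.
move=> meta ms mx; have msx := measurable_fun_pair ms mx.
exact: (measurableT_comp (meta n) msx).
Qed.

Lemma measurable_pbias (dT : measure_display) (T : measurableType dT)
    (R : realType) (P : probability T R) (d n : nat) (eta : d.-tuple R -> R)
    (etahat : estimator R d) (D : 'I_n -> T -> obs R d) :
  measurable_fun setT eta -> measurable_estimator etahat ->
  measurable_fun setT (sample D) ->
  measurable_fun setT (pbias P eta etahat D).
Proof.
move=> meta metahat mD; rewrite /pbias unlock.
have m2 : measurable_fun setT (fun sx : T * d.-tuple R => sx.2).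
  exact: measurable_snd.
have m1 : measurable_fun setT (fun sx : T * d.-tuple R => sample D sx.1).
  exact: (measurableT_comp mD measurable_fst).
apply: (@measurable_fine_integral _ _ _ _ _ P (fun sx : T * d.-tuple R =>
    @etahat n (sample D sx.1) sx.2 - eta sx.2)).
apply: measurable_funB; last exact: measurableT_comp meta m2.
exact: (measurable_estimator_comp metahat m1 m2).
Qed.

(** * Moments of the influence function error *)

Section moments.
Context (R : realType) (d : nat) (PZ : probability (obs R d) R)
  (dT : measure_display) (T : measurableType dT) (P : probability T R)
  (n : nat) (Dpi Dmu Dphi : 'I_n -> T -> obs R d) (pihat muhat : estimator R d).
Hypothesis hiid : iid_copies P PZ (join3 Dpi Dmu Dphi).
Hypotheses (mpihat : measurable_estimator pihat)
  (mmuhat : measurable_estimator muhat)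
  (iA : PZ.-integrable setT (EFin \o @obsA R d))
  (iY : PZ.-integrable setT (EFin \o @obsY R d)).

Local Notation tX := (d.-tuple R).
Local Notation tS := (n.-tuple (obs R d)).
Local Notation pi := (pi_reg PZ).
Local Notation mu := (mu_reg PZ).
Local Notation training := (training Dpi Dmu).

(** This and [err_mu] are u and v of the overview, written as functions of the conditioning triple
    [design i]. *)
Definition err_pi (k : tX * tS * tS) : R := @pihat n k.1.2 k.1.1 - pi k.1.1.
Definition err_mu (k : tX * tS * tS) : R := @muhat n k.2 k.1.1 - mu k.1.1.
Definition design i t : tX * tS * tS :=
  (obsX (Dphi i t), sample Dpi t, sample Dmu t).
Definition phi_error i t : R :=
  phihat pihat muhat Dpi Dmu t (Dphi i t) - phi0 PZ (Dphi i t).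
Definition bias_prod (x : tX) : R :=
  pbias P pi pihat Dpi x * pbias P mu muhat Dmu x.

Let mpi : measurable_fun setT pi.
Proof. by have [] := condEP (@measurable_obsX R d) iA. Qed.

Let mmu : measurable_fun setT mu.
Proof. by have [] := condEP (@measurable_obsX R d) iY. Qed.

Let m11 : measurable_fun setT (fun k : tX * tS * tS => k.1.1).
Proof. exact: measurableT_comp. Qed.

Lemma measurable_err_pi : measurable_fun setT err_pi.
Proof.
apply: measurable_funB; last exact: measurableT_comp mpi m11.
apply: (measurable_estimator_comp mpihat (s := fun k : tX * tS * tS => k.1.2) _ m11).
exact: measurableT_comp.
Qed.

Lemma measurable_err_mu : measurable_fun setT err_mu.
Proof.
apply: measurable_funB; last exact: measurableT_comp mmu m11.
apply: (measurable_estimator_comp mmuhat (s := fun k : tX * tS * tS => k.2) _ m11).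
exact: measurable_snd.
Qed.

Lemma measurable_design i : measurable_fun setT (design i).
Proof.
apply: measurable_fun_pair; last exact: measurable_sample_mu hiid.
apply: measurable_fun_pair; last exact: measurable_sample_pi hiid.
apply: (measurableT_comp (@measurable_obsX R d)); exact: measurable_Dphi hiid i.
Qed.

(** Not squared yet: w as a function of the independent pair formed by an observation and the
    training data, the form that Tonelli's theorem takes. *)
Let sq_err (zs : obs R d * (tS * tS)) : R :=
  phi (@pihat n zs.2.1) (@muhat n zs.2.2) zs.1 - phi0 PZ zs.1.

Let msq_err : measurable_fun setT sq_err.
Proof.
have mx : measurable_fun setT (fun zs : obs R d * (tS * tS) => obsX zs.1).
  by apply: (measurableT_comp (@measurable_obsX R d)).
apply: measurable_funB; last first.
  by apply: (measurableT_comp (measurable_phi mpi mmu)).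
have m21 : measurable_fun setT (fun zs : obs R d * (tS * tS) => zs.2.1).
  exact: measurableT_comp.
have m22 : measurable_fun setT (fun zs : obs R d * (tS * tS) => zs.2.2).
  exact: measurableT_comp.
apply: measurable_funM; apply: measurable_funB.
- by apply: (measurableT_comp (@measurable_obsA R d)).
- exact: (measurable_estimator_comp mpihat m21 mx).
- by apply: (measurableT_comp (@measurable_obsY R d)).
- exact: (measurable_estimator_comp mmuhat m22 mx).
Qed.

Lemma measurable_phi_error i : measurable_fun setT (phi_error i).
Proof.
apply: (measurableT_comp msq_err (g := fun t => (Dphi i t, training t))).
apply: measurable_fun_pair; first exact: measurable_Dphi hiid i.
exact: measurable_training hiid.
Qed.

(** An observation of [Dphi] is independent of the training data; integrating it out first leaves
    the squared norm for a fixed fit. The identity holds in the extended reals, so it can transfer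
    finiteness. *)
Lemma mean_sq_errorE i :
  mean_sq_error P PZ pihat muhat Dpi Dmu =
  (\int[P]_t (phi_error i t ^+ 2)%:E)%E.
Proof.
have mF : measurable_fun setT (fun zs => (sq_err zs ^+ 2)%:E).
  by apply/measurable_EFinP; exact: measurable_funX.
rewrite [RHS](indep_tonelli (measurable_Dphi hiid i) (measurable_training hiid)
  (indep_Dphi_training hiid i) mF); last by move=> zs; rewrite lee_fin sqr_ge0.
apply: eq_integral => t _; rewrite norm2_sqr.
rewrite -(integral_law (measurable_Dphi hiid i) (law_Dphi hiid i))//.
apply/measurable_EFinP/measurable_funX.
apply: (measurableT_comp msq_err (g := fun z => (z, training t))).
exact: measurable_fun_pair.
Qed.

Lemma measurable_bias_prod : measurable_fun setT bias_prod.
Proof.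
apply: measurable_funM.
- exact: measurable_pbias mpi mpihat (measurable_sample_pi hiid).
- exact: measurable_pbias mmu mmuhat (measurable_sample_mu hiid).
Qed.

(** Valid at every [x], also where an expectation diverges, thanks to the unconditional form of
    [indep_integralM]. *)
Lemma bias_prodE x :
  bias_prod x = fine (\int[P]_t (err_pi (x, sample Dpi t, sample Dmu t) *
                                 err_mu (x, sample Dpi t, sample Dmu t))%:E)%E.
Proof.
have mp : measurable_fun setT (fun s : tS => @pihat n s x - pi x).
  apply: measurable_funB => //.
  by apply: (@measurable_estimator_comp _ _ n _ _ _ id (cst x) mpihat).
have mm : measurable_fun setT (fun s : tS => @muhat n s x - mu x).
  apply: measurable_funB => //.
  by apply: (@measurable_estimator_comp _ _ n _ _ _ id (cst x) mmuhat).
rewrite /bias_prod /pbias unlock.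
rewrite -(indep_integralM (measurableT_comp mp (measurable_sample_pi hiid))
  (measurableT_comp mm (measurable_sample_mu hiid)))//.
exact: indep2_comp (indep_samples hiid).
Qed.

Let res_pi z := obsA z - pi (obsX z).
Let res_mu z := obsY z - mu (obsX z).

Let res_piP := is_condE_residual (@measurable_obsX R d)
  (condEP (@measurable_obsX R d) iA).
Let res_muP := is_condE_residual (@measurable_obsX R d)
  (condEP (@measurable_obsX R d) iY).

Hypothesis mse : (mean_sq_error P PZ pihat muhat Dpi Dmu < +oo)%E.

Let MSE : R := fine (mean_sq_error P PZ pihat muhat Dpi Dmu).

Lemma sq_integrable_phi_error i : sq_integrable P (phi_error i).
Proof.
by apply: sq_integrable_fin; [exact: measurable_phi_error|rewrite -mean_sq_errorE].
Qed.

(* Used with [H] the training data, alone or together with another observation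
   of [Dphi]; the latter yields the decorrelation of distinct errors. *)
Lemma phi_error_condE_of i (d2 : measure_display) (T2 : measurableType d2)
    (H : T -> T2) (s : tX * T2 -> tX * tS * tS) :
  measurable_fun setT H -> measurable_fun setT s -> indep2 P (Dphi i) H ->
  (forall t, s (obsX (Dphi i t), H t) = design i t) ->
  let K t := (obsX (Dphi i t), H t) in
  sq_integrable P ((err_pi \* err_mu) \o design i) /\
  is_condE P (phi_error i) K ((err_pi \* err_mu) \o s).
Proof.
move=> mH ms ZH sK K.
have mD := measurable_Dphi hiid i.
have mK : measurable_fun setT K.
  apply: measurable_fun_pair => //.
  exact: (measurableT_comp (@measurable_obsX R d)).
have wE : phi_error i =
    fun t => (res_pi (Dphi i t) - (err_pi \o s) (K t)) *
      (res_mu (Dphi i t) - (err_mu \o s) (K t)) -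
      res_pi (Dphi i t) * res_mu (Dphi i t).
  apply/funext => t /=; rewrite sK /phi_error /phihat /phi0 /phi /err_pi /err_mu.
  rewrite /res_pi /res_mu /=; ring.
have [ia a0] := res_piP; have [iy y0] := res_muP.
have := @product_condE _ _ _ _ _ P K (err_pi \o s) (err_mu \o s)
  (res_pi \o Dphi i) (res_mu \o Dphi i) mK
  (measurableT_comp measurable_err_pi ms) (measurableT_comp measurable_err_mu ms)
  (integrable_law mD (law_Dphi hiid i) ia) (integrable_law mD (law_Dphi hiid i) iy)
  (indep_residual_integral0 (@measurable_obsX R d) ia a0 mD mH (law_Dphi hiid i) ZH)
  (indep_residual_integral0 (@measurable_obsX R d) iy y0 mD mH (law_Dphi hiid i) ZH).
rewrite -wE => /(_ (sq_integrable_phi_error i)) [h1 h2]; split=> //.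
rewrite (_ : _ \o design i = ((err_pi \o s) \* (err_mu \o s)) \o K)//.
by apply/funext => t /=; rewrite -sK.
Qed.

Definition cond_error i t : R := err_pi (design i t) * err_mu (design i t).

Definition mean_error i t : R := bias_prod (obsX (Dphi i t)).

Let merr2 : measurable_fun setT (err_pi \* err_mu).
Proof. exact: measurable_funM measurable_err_pi measurable_err_mu. Qed.

Lemma phi_error_condE i :
  sq_integrable P (cond_error i) /\
  is_condE P (phi_error i) (design i) (err_pi \* err_mu).
Proof.
(* [s] only reassociates the conditioning variables, so the information is unchanged. *)
pose s (xh : tX * (tS * tS)) : tX * tS * tS := (xh.1, xh.2.1, xh.2.2).
have ms : measurable_fun setT s.
  apply: measurable_fun_pair; last exact: measurableT_comp.
  by apply: measurable_fun_pair => //; exact: measurableT_comp.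
have [//|h1 h2] := @phi_error_condE_of i _ _ training s (measurable_training hiid)
  ms (indep_Dphi_training hiid i).
by split=> //; exact: (is_condE_coarser ms merr2 h2).
Qed.

Lemma bhat_ae i :
  ae_eq P setT (bhat P PZ pihat muhat Dpi Dmu Dphi i) (cond_error i).
Proof.
have [_ h] := phi_error_condE i.
apply: (is_condE_ae_unique (measurable_design i) _ h).
apply: condEP; first exact: measurable_design.
exact: sq_integrable_integrable (sq_integrable_phi_error i).
Qed.

(** Given the i-th covariate, the training data and the j-th observation, the j-th centred error is
    known while the i-th has conditional mean 0. *)
Lemma phi_error_orthogonal i j : i != j ->
  \int[P]_t ((phi_error i t - cond_error i t) *
             (phi_error j t - cond_error j t)) = 0.
Proof.
move=> ij.
pose H t := (training t, Dphi j t).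
have mH : measurable_fun setT H.
  apply: measurable_fun_pair; first exact: measurable_training hiid.
  exact: measurable_Dphi hiid j.
pose s (xh : tX * (tS * tS * obs R d)) : tX * tS * tS :=
  (xh.1, xh.2.1.1, xh.2.1.2).
have m21 : measurable_fun setT (fun xh : tX * (tS * tS * obs R d) => xh.2.1).
  exact: measurableT_comp.
have m22 : measurable_fun setT (fun xh : tX * (tS * tS * obs R d) => xh.2.2).
  exact: measurableT_comp.
have m211 := measurableT_comp measurable_fst m21.
have m212 := measurableT_comp measurable_snd m21.
have ms : measurable_fun setT s.
  apply: measurable_fun_pair => //.
  by apply: measurable_fun_pair => //; exact: measurable_fst.
have [//|_ h] := @phi_error_condE_of i _ _ H s mH ms
  (indep_Dphi_training_Dphi hiid ij).
have mXi : measurable_fun setT (fun t => obsX (Dphi i t)).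
  by apply: (measurableT_comp (@measurable_obsX R d)); exact: measurable_Dphi hiid i.
have mK := measurable_fun_pair mXi mH.
have [ia a0] := is_condE_residual mK h.
(* The j-th centred error recomputed from the conditioning variables; it serves as the unbounded
   weight of [integral_weight_eq0]. *)
pose k (xh : tX * (tS * tS * obs R d)) : R := sq_err (xh.2.2, xh.2.1) -
  (err_pi \* err_mu) (obsX xh.2.2, xh.2.1.1, xh.2.1.2).
have mk : measurable_fun setT k.
  apply: measurable_funB.
    exact: (measurableT_comp msq_err (measurable_fun_pair m22 m21)).
  apply: (measurableT_comp merr2
    (measurable_fun_pair (measurable_fun_pair _ m211) m212)).
  exact: (measurableT_comp (@measurable_obsX R d) m22).
have [hbi _] := phi_error_condE i; have [hbj _] := phi_error_condE j.
have iak := sq_integrableM (sq_integrableB (sq_integrable_phi_error i) hbi)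
  (sq_integrableB (sq_integrable_phi_error j) hbj).
by rewrite /Rintegral (integral_weight_eq0 mK mk ia a0 iak).
Qed.

(** Freezing all covariates averages u v over the training data alone, and [bias_prodE] factorises
    that average. Conditioning on all of [sampleX], although one covariate matters, matches the
    definition of Sigma. *)
Lemma cond_error_condE i :
  is_condE P (cond_error i) (sampleX Dphi) (fun xs => bias_prod (tnth xs i)).
Proof.
pose F (sx : (tS * tS) * n.-tuple tX) : R :=
  (err_pi \* err_mu) (tnth sx.2 i, sx.1.1, sx.1.2).
have mF : measurable_fun setT F.
  apply: (measurableT_comp merr2); apply: measurable_fun_pair; last first.
    exact: measurableT_comp.
  apply: measurable_fun_pair; last exact: measurableT_comp.
  exact: (measurableT_comp (measurable_tnth i) measurable_snd).
have FE t : F (training t, sampleX Dphi t) = cond_error i t.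
  by rewrite /F /= tnth_mktuple.
have [h _] := phi_error_condE i.
have iF : P.-integrable setT (fun t => (F (training t, sampleX Dphi t))%:E).
  under eq_fun do rewrite FE.
  exact: sq_integrable_integrable h.
have := indep_condE (measurable_training hiid) (measurable_sampleX hiid)
  (indep_training_sampleX hiid) mF iF.
congr is_condE; first exact/funext.
by apply/funext => xs; rewrite bias_prodE.
Qed.

Let mean_errorE i t : bias_prod (tnth (sampleX Dphi t) i) = mean_error i t.
Proof. by rewrite tnth_mktuple. Qed.

Lemma sq_integrable_mean_error i : sq_integrable P (mean_error i).
Proof.
have [h _] := phi_error_condE i.
have [+ _] := is_condE_sq_integrable (measurable_sampleX hiid) (cond_error_condE i) h.
by congr sq_integrable; apply/funext => t /=; rewrite mean_errorE.
Qed.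

Let sqrE f : sq_integrable P f ->
  (\int[P]_t (f t ^+ 2)%:E = (\int[P]_t (f t ^+ 2))%:E)%E.
Proof.
by move=> [_ if2]; rewrite /Rintegral fineK// (integrable_fin_num measurableT if2).
Qed.

Lemma Rintegral_sqr_phi_error i : \int[P]_t (phi_error i t ^+ 2) = MSE.
Proof. by rewrite /MSE (mean_sq_errorE i). Qed.

Lemma Rintegral_sqr_cond_error_le i : \int[P]_t (cond_error i t ^+ 2) <= MSE.
Proof.
have [h c] := phi_error_condE i.
have [_] := is_condE_sq_integrable (measurable_design i) c (sq_integrable_phi_error i).
by rewrite (sqrE h) (sqrE (sq_integrable_phi_error i)) lee_fin Rintegral_sqr_phi_error.
Qed.

Lemma Rintegral_sqr_mean_error_le i : \int[P]_t (mean_error i t ^+ 2) <= MSE.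
Proof.
have [h _] := phi_error_condE i.
have [_] := is_condE_sq_integrable (measurable_sampleX hiid) (cond_error_condE i) h.
under eq_integral do rewrite mean_errorE.
rewrite (sqrE (sq_integrable_mean_error i)) (sqrE h) lee_fin => /le_trans; apply.
exact: Rintegral_sqr_cond_error_le.
Qed.

Let m : R := \int[PZ]_z bias_prod (obsX z).

Let Rintegral_mean_error i : \int[P]_t mean_error i t = m.
Proof.
rewrite /Rintegral; congr fine.
apply: (integral_law (measurable_Dphi hiid i) (law_Dphi hiid i)
  (f := fun z => (bias_prod (obsX z))%:E)).
apply/measurable_EFinP.
exact: (measurableT_comp measurable_bias_prod (@measurable_obsX R d)).
Qed.

Let centered i : \int[P]_t (mean_error i t - m) = 0.
Proof.
rewrite RintegralB//; last 2 first.
- exact: sq_integrable_integrable (sq_integrable_mean_error i).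
- exact: sq_integrable_integrable (sq_integrable_cst P m).
rewrite Rintegral_mean_error Rintegral_cst// [X in fine X]probability_setT.
by rewrite mulr1 subrr.
Qed.

Lemma sqr_mean_le (i : 'I_n) : m ^+ 2 <= MSE.
Proof.
apply: le_trans (Rintegral_sqr_mean_error_le i).
have hk := sq_integrable_mean_error i; have [_ ik2] := hk.
have ik := sq_integrable_integrable hk.
have i2mk : P.-integrable setT (EFin \o (fun t => 2 * m * mean_error i t)).
  exact: (integrableZl measurableT (2 * m) ik).
have im2 : P.-integrable setT (EFin \o cst (m ^+ 2)).
  exact: sq_integrable_integrable (sq_integrable_cst P (m ^+ 2)).
have : 0 <= \int[P]_t
    (mean_error i t ^+ 2 - 2 * m * mean_error i t + cst (m ^+ 2) t).
  apply: Rintegral_ge0 => t _ /=.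
  by rewrite (_ : _ + _ = (mean_error i t - m) ^+ 2) ?sqr_ge0//; ring.
rewrite RintegralD//; last exact: (integrableB measurableT ik2 i2mk).
rewrite RintegralB// RintegralZl// Rintegral_mean_error Rintegral_cst//.
by rewrite [X in fine X]probability_setT/= mulr1; lra.
Qed.

Lemma mean_error_orthogonal i j : i != j ->
  \int[P]_t ((mean_error i t - m) * (mean_error j t - m)) = 0.
Proof.
move=> ij.
have mc : measurable_fun setT (fun x : tX => bias_prod x - m).
  by apply: measurable_funB => //; exact: measurable_bias_prod.
have mX k : measurable_fun setT (fun t => obsX (Dphi k t)).
  by apply: (measurableT_comp (@measurable_obsX R d)); exact: measurable_Dphi hiid k.
have := indep_integralM (measurableT_comp mc (mX i)) (measurableT_comp mc (mX j))
  (indep2_comp mc mc (indep_obsX_obsX hiid ij)).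
rewrite /Rintegral => ->.
by have := centered i; rewrite /Rintegral => ->; rewrite mul0r.
Qed.

(** Sigma is built from chosen versions. [bhat] is replaced by u v and its conditional mean by the
    product of biases, almost everywhere; the outer expectation then removes the conditional
    covariance by the tower property. *)
Lemma Sigma_mxE i j :
  Sigma_mx P PZ pihat muhat Dpi Dmu Dphi i j =
  \int[P]_t ((cond_error i t - mean_error i t) *
             (cond_error j t - mean_error j t)).
Proof.
have mSX := measurable_sampleX hiid.
pose b k := bhat P PZ pihat muhat Dpi Dmu Dphi k.
have mb k : measurable_fun setT (b k).
  have [mg _ _ _] := condEP (measurable_design k)
    (sq_integrable_integrable (sq_integrable_phi_error k)).
  exact: (measurableT_comp mg (measurable_design k)).
have bE k : is_condE P (b k) (sampleX Dphi) (fun xs => bias_prod (tnth xs k)).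
  apply: is_condE_ae (cond_error_condE k) mSX => //.
  by apply: ae_eq_sym; exact: bhat_ae.
have cE k : is_condE P (b k) (sampleX Dphi) (condE P (b k) (sampleX Dphi)).
  by apply: condEP => //; have [] := bE k.
have ckE k : ae_eq P setT
    (fun t => b k t - condE P (b k) (sampleX Dphi) (sampleX Dphi t))
    (fun t => cond_error k t - mean_error k t).
  have h1 := is_condE_ae_unique mSX (cE k) (bE k).
  have h2 := bhat_ae k.
  apply: filterS2 h1 h2 => t /= h1 h2 _.
  by rewrite h1// mean_errorE -h2.
have iU : P.-integrable setT (EFin \o (fun t => (cond_error i t - mean_error i t) *
             (cond_error j t - mean_error j t))).
  have [hi _] := phi_error_condE i; have [hj _] := phi_error_condE j.
  exact: (sq_integrableM (sq_integrableB hi (sq_integrable_mean_error i))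
    (sq_integrableB hj (sq_integrable_mean_error j))).
rewrite mxE unlock /Rintegral; congr fine; rewrite /condCov -/(b i) -/(b j).
set U := fun t => _ * _.
have mU : measurable_fun setT U.
  have mc k : measurable_fun setT
      (fun t => b k t - condE P (b k) (sampleX Dphi) (sampleX Dphi t)).
    apply: measurable_funB => //; have [mg _ _ _] := cE k.
    exact: (measurableT_comp mg mSX).
  exact: (measurable_funM (mc i) (mc j)).
have UE0 : ae_eq P setT (fun t => (cond_error i t - mean_error i t) *
    (cond_error j t - mean_error j t)) U.
  by apply: filterS2 (ckE i) (ckE j) => t /= h1 h2 _; rewrite /U h1// h2.
have [iU' UE] := ae_eq_integrable mU UE0 iU.
have [_ _ _ /(_ setT measurableT)] := condEP mSX iU'.
rewrite preimage_setT => <-.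
by rewrite (UE setT).
Qed.

Lemma sqr_integral_phi_error_le : (0 < n)%N ->
  \int[P]_t ((n%:R^-1 * (\sum_i phi_error i t) - m) ^+ 2) <=
  24 * ((MSE + spectral_radius (Sigma_mx P PZ pihat muhat Dpi Dmu Dphi)) / n%:R).
Proof.
move=> n0; set S := Sigma_mx _ _ _ _ _ _ _.
have i0 : 'I_n by exact: Ordinal n0.
apply: (second_moment_bound n0 (b := cond_error) (k := mean_error)).
- rewrite -(Rintegral_sqr_phi_error i0).
  by apply: Rintegral_ge0 => t _; exact: sqr_ge0.
- exact: spectral_radius_ge0.
- exact: sq_integrable_phi_error.
- by move=> i; have [] := phi_error_condE i.
- exact: sq_integrable_mean_error.
- by move=> i; rewrite Rintegral_sqr_phi_error.
- exact: Rintegral_sqr_cond_error_le.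
- exact: Rintegral_sqr_mean_error_le.
- exact: sqr_mean_le i0.
- exact: phi_error_orthogonal.
- exact: mean_error_orthogonal.
- have symS : S^T = S.
    apply/matrixP => i j; rewrite mxE !Sigma_mxE.
    by apply: eq_Rintegral => t _; rewrite mulrC.
  (* At the all-ones vector the quadratic form is the sum of all entries of [S], and the sum of
     squares is [n]. *)
  have := quadratic_form_le (const_mx 1) symS.
  congr (_ <= _).
    rewrite mxE exchange_big/=; apply: eq_bigr => j _.
    rewrite !mxE mulr1; apply: eq_bigr => i _.
    by rewrite mxE mul1r Sigma_mxE.
  rewrite mulrC; congr (_ * _).
  under eq_bigr do rewrite mxE expr1n.
  by rewrite sumr_const card_ord.
Qed.

End moments.

(** * Decomposition, bias bound and rate *)

Theorem lemma1 (R : realType) (d : nat) (PZ : probability (obs R d) R)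
    (dT : measure_display) (T : measurableType dT) (P : probability T R)
    (Dpi Dmu Dphi : forall n : nat, 'I_n -> T -> obs R d)
    (pihat muhat : estimator R d)
    (hiid : forall n, iid_copies P PZ (join3 (Dpi n) (Dmu n) (Dphi n)))
    (mpihat : measurable_estimator pihat)
    (mmuhat : measurable_estimator muhat)
    (hmoment : bounded_moment PZ)
    (hdensity : bounded_density PZ) :
  exists (R1 : nat -> R) (R2 : nat -> T -> R),
    [/\ forall n, (0 < n)%N -> forall t : T,
          psihat pihat muhat (Dpi n) (Dmu n) (Dphi n) t - psi_ecc PZ =
          emp_mean (Dphi n) t (phi0 PZ) - fine 'E_PZ[phi0 PZ] + R1 n + R2 n t,
        forall n, (0 < n)%N ->
          ((R1 n)%:E <=
            norm2 PZ (fun z => pbias P (pi_reg PZ) pihat (Dpi n) (obsX z)) *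
            norm2 PZ (fun z => pbias P (mu_reg PZ) muhat (Dmu n) (obsX z)))%E &
        bounded_in_prob P R2
          (fun n => R2_rate P PZ pihat muhat (Dpi n) (Dmu n) (Dphi n))].
Proof.
have [iA iY _ _] := hmoment.
pose R1 n : R :=
  \int[PZ]_z bias_prod PZ P (Dpi n) (Dmu n) pihat muhat (obsX z).
pose R2 n t : R := emp_mean (Dphi n) t (phihat pihat muhat (Dpi n) (Dmu n) t) -
  emp_mean (Dphi n) t (phi0 PZ) - R1 n.
exists R1, R2; split.
(* [R2] is by definition the remainder, so only the identification of [psi_ecc] is needed. *)
- by move=> n n0 t; rewrite psi_eccE// /psihat /R2; ring.
- move=> n n0.
  have [mpi _ _ _] := condEP (@measurable_obsX R d) iA.
  have [mmu _ _ _] := condEP (@measurable_obsX R d) iY.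
  have mbpi := measurableT_comp (measurable_pbias P mpi mpihat
    (measurable_sample_pi (hiid n))) (@measurable_obsX R d).
  have mbmu := measurableT_comp (measurable_pbias P mmu mmuhat
    (measurable_sample_mu (hiid n))) (@measurable_obsX R d).
  have mb := measurable_funM mbpi mbmu.
  have half : (2 : R)^-1 + 2^-1 = 1 by field.
  apply: le_trans (hoelder PZ mbpi mbmu _ _ half) => //.
  rewrite Lnorm1.
  apply: le_trans (le_abse_integral PZ measurableT _); last exact/measurable_EFinP.
  rewrite /R1 /Rintegral; set I := integral _ _ _; rewrite -/I.
  (* If the integral is infinite, [R1 n] is 0 and the bound is trivial. *)
  by case: I => [r| |]; rewrite ?lee_fin ?ler_norm// leey.
(* 24 comes from the second moment bound, and [tail_bound] with [C = 24] turns it into this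
   threshold, the same for all [n]. *)
- move=> e e0; exists (Num.sqrt (24 / e)); first by rewrite sqrtr_gt0 divr_gt0.
  near=> n.
  have n0 : (0 < n)%N by near: n; exists 1%N.
  have nR0 : 0 < n%:R^-1 :> R by rewrite invr_gt0 ltr0n.
  set S := spectral_radius (Sigma_mx P PZ pihat muhat (Dpi n) (Dmu n) (Dphi n)).
  (* With an infinite mean squared error the rate is [+oo] and the event is empty. *)
  have [mse|] := ltP (mean_sq_error P PZ pihat muhat (Dpi n) (Dmu n)) +oo%E; last first.
    rewrite leye_eq => /eqP mse.
    rewrite /R2_rate mse addye// gt0_mulye ?lte_fin//=.
    rewrite gt0_muley ?lte_fin ?sqrtr_gt0 ?divr_gt0//.
    rewrite (_ : [set t | _] = set0) ?measure0 ?lee_fin ?ltW//.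
    by apply/seteqP; split=> t //=; rewrite ltNge leey.
  have R2E t : R2 n t = n%:R^-1 *
      (\sum_i phi_error PZ (Dpi n) (Dmu n) (Dphi n) pihat muhat i t) - R1 n.
    by rewrite /R2 /emp_mean -mulrBr -sumrB.
  have bnd := sqr_integral_phi_error_le (hiid n) mpihat mmuhat iA iY mse n0.
  set V := fine (mean_sq_error P PZ pihat muhat (Dpi n) (Dmu n)) in bnd.
  have mse0 : (0 <= mean_sq_error P PZ pihat muhat (Dpi n) (Dmu n))%E.
    apply: integral_ge0 => t _; rewrite norm2_sqr integral_ge0// => z _.
    by rewrite lee_fin sqr_ge0.
  have VE : mean_sq_error P PZ pihat muhat (Dpi n) (Dmu n) = V%:E.
    by rewrite /V fineK// ge0_fin_numE.
  have S0 : 0 <= S by exact: spectral_radius_ge0.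
  have V0 : 0 <= V by exact: fine_ge0.
  have rateE : R2_rate P PZ pihat muhat (Dpi n) (Dmu n) (Dphi n) =
      (Num.sqrt ((V + S) / n%:R))%:E by rewrite /R2_rate VE.
  rewrite rateE.
  under eq_set do rewrite -EFinM lte_fin.
  apply: tail_bound => //.
  + have h := sq_integrable_sum (index_enum 'I_n)
      (fun i => sq_integrable_phi_error (hiid n) mpihat mmuhat iA iY mse i).
    have := sq_integrableB (sq_integrableZ n%:R^-1 h) (sq_integrable_cst P (R1 n)).
    by congr sq_integrable; apply/funext => t; rewrite R2E.
  + by rewrite mulr_ge0 ?addr_ge0// ltW.
  + by under eq_Rintegral do rewrite R2E.
Unshelve. all: by end_near. Qed.
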